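(* Let $n\ge1$ and $\mathcal M:=\{g:[0,1)\to\mathbb R\mid g\text{ is increasing (not necessarily strictly) and left-continuous}\}$. In the Poisson point process model with intensity $\lambda_g(x,y)=n\mathbf 1(y\ge g(x))$ on $[0,1]\times\mathbb R$, the nonparametric maximum-likelihood estimator $(\hat g^{Mon}(x),x\in[0,1))$, $$\hat g^{Mon}(x)=\min_{i:X_i\ge x}Y_i,\qquad x\in[0,1),$$ is a sufficient and complete statistic for the parameter class $g\in\mathcal M$.
   Context: Under $P_g$ (expectation $\mathbb E_g$) one observes the points $(X_j,Y_j)_{j\ge1}$ of a Poisson point process with intensity $\lambda_g$. The statistic $\hat g^{Mon}$ takes values (a.s.) in $\mathcal M$, equipped with the ball $\sigma$-algebra for the uniform norm, which is generated by the point evaluations $f\mapsto f(x)$, $x\in[0,1)$. Sufficiency and completeness are with respect to $\{P_g:g\in\mathcal M\}$; completeness means: if $T:\mathcal M\to\mathbb R$ is measurable with $\mathbb E_g[T(\hat g^{Mon})]=0$ for all $g\in\mathcal M$, then $T(\hat g^{Mon})=0$ $P_g$-a.s. for all $g\in\mathcal M$. *)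

(* Defs.v *)
From HB Require Import structures.
From mathcomp Require Import all_boot all_order all_algebra.
From mathcomp Require Import all_classical all_reals all_analysis.
From mathcomp Require Import measurable_realfun.

Set Implicit Arguments.
Unset Strict Implicit.
Unset Printing Implicit Defensive.

Import Order.TTheory GRing.Theory Num.Theory.
Import numFieldTopology.Exports numFieldNormedType.Exports.

Local Open Scope classical_set_scope.
Local Open Scope ring_scope.

Section MonotoneClass.
Variable R : realType.

Definition unit_co : set R := [set x | 0 <= x < 1].

Definition increasing (g : unit_co -> R) :=
  forall x y : unit_co, \val x <= \val y -> g x <= g y.

Definition left_continuous (g : unit_co -> R) :=
  forall x : unit_co,
    g @ within [set y : unit_co | \val y < \val x] (nbhs x) --> g x.

Record monotone_fun := MonotoneFun {
  monotone_val :> unit_co -> R;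
  monotone_increasing : increasing monotone_val;
  monotone_left_continuous : left_continuous monotone_val }.

Lemma increasing0 : increasing (fun=> 0).
Proof. by []. Qed.

Lemma left_continuous0 : left_continuous (fun=> 0).
Proof. by move=> x; exact: cvg_cst. Qed.

HB.instance Definition _ := gen_eqMixin monotone_fun.
HB.instance Definition _ := gen_choiceMixin monotone_fun.
HB.instance Definition _ := isPointed.Build monotone_fun
  (MonotoneFun increasing0 left_continuous0).

Definition point_evaluations : set (set monotone_fun) :=
  [set E | exists (x : unit_co) (B : set R),
     measurable B /\ E = [set g : monotone_fun | B (g x)]].

Definition mono : measurableType point_evaluations.-sigma :=
  g_sigma_algebraType point_evaluations.

Definition mono_eval (g : mono) : unit_co -> R := monotone_val g.

End MonotoneClass.

Arguments unit_co : clear implicits.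

Section PoissonPointProcess.
Variables (R : realType) (d : measure_display) (Omega : measurableType d).

Let plane := (measurableTypeR R * measurableTypeR R)%type.

(* The points of a locally finite point process on [0,1] x R, enumerated by
   nat; since [0,1] is compact, a compact set has bounded second coordinate. *)
Definition point_process (xi : nat -> Omega -> plane) :=
  [/\ forall j, measurable_fun setT (xi j),
      forall j w, 0 <= (xi j w).1 <= 1 &
      forall w (c : R), finite_set [set j | `|(xi j w).2| <= c]].

Definition count (xi : nat -> Omega -> plane) (A : set plane) (w : Omega)
    : \bar R :=
  (\sum_(j <oo) \d_(xi j w) A)%E.

(* The explicit Poisson weights are used because [poisson_pmf 0 k] is 1 for
   every k. *)
Definition poisson_process (P : probability Omega R)
    (Lambda : set plane -> \bar R) (xi : nat -> Omega -> plane) :=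
  [/\ forall A, measurable A -> (Lambda A < +oo)%E -> forall k : nat,
        P (count xi A @^-1` [set k%:R%:E]) =
        (expR (- fine (Lambda A)) * fine (Lambda A) ^+ k / k`!%:R)%:E,
      forall A, measurable A -> Lambda A = +oo%E ->
        P (count xi A @^-1` [set +oo%E]) = 1%E &
      forall (k : nat) (A : 'I_k -> set plane) (B : 'I_k -> set (\bar R)),
        (forall i, measurable (A i)) -> trivIset setT A ->
        (forall i, measurable (B i)) ->
        P (\bigcap_i (count xi (A i) @^-1` B i)) =
        (\prod_(i < k) P (count xi (A i) @^-1` B i))%E].

(* The observation is the point process, i.e. the random measure
   [A |-> count xi A]; the order in which the points are enumerated carries no
   information. *)
Definition observed_events (xi : nat -> Omega -> plane) : set (set Omega) :=
  <<s [set E | exists (A : set plane) (B : set (\bar R)),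
         [/\ measurable A, measurable B & E = count xi A @^-1` B]] >>.

End PoissonPointProcess.

Section Model.
Variable R : realType.

(* The line x = 1, on which g is not defined, is a null set: the density is
   taken to be 0 there. *)
Definition intensity (n : R) (g : mono R) (p : R * R) : R :=
  if (insub p.1 : option (unit_co R)) is Some x
  then n * (mono_eval g x <= p.2)%R%:R else 0.

Definition intensity_measure (n : R) (g : mono R)
    (A : set (measurableTypeR R * measurableTypeR R)) : \bar R :=
  (\int[lebesgue_measure \x lebesgue_measure]_(p in A)
     (intensity n g p)%:E)%E.

Definition is_min (A : set R) (m : R) := A m /\ lbound A m.

Definition is_mon_mle (p : nat -> R * R) (m : mono R) :=
  forall x : unit_co R,
    is_min [set (p i).2 | i in [set i | \val x <= (p i).1]] (mono_eval m x).

(* The value is arbitrary when some minimum does not exist or when the resulting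
   function is not in the class. *)
Definition mon_mle (Omega : Type) (xi : nat -> Omega -> R * R) (w : Omega)
    : mono R :=
  xget point (is_mon_mle (xi ^~ w)).

End Model.

Section Statistics.
Variables (R : realType) (d d' : measure_display).
Variables (Omega : measurableType d) (E : measurableType d') (Theta : Type).
Variables (P : Theta -> probability Omega R) (obs : set (set Omega)).

Definition statistic (S : Omega -> E) :=
  forall B, measurable B -> obs (S @^-1` B).

(* [h \o S] is a version of the conditional probability Q(A | S). *)
Definition cond_prob_version (Q : probability Omega R) (S : Omega -> E)
    (A : set Omega) (h : E -> R) :=
  [/\ measurable_fun setT h, Q.-integrable setT (EFin \o (h \o S)) &
      forall B, measurable B ->
        Q (A `&` S @^-1` B) = (\int[Q]_(w in S @^-1` B) (h (S w))%:E)%E].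

(* One version of the conditional probabilities given S serves all parameters:
   the quantifier on h comes before the one on theta. *)
Definition sufficient_statistic (S : Omega -> E) :=
  forall A, obs A ->
    exists h, forall theta, cond_prob_version (P theta) S A h.

Definition complete_statistic (S : Omega -> E) :=
  forall T : E -> R, measurable_fun setT T ->
    (forall theta, (P theta).-integrable setT (EFin \o (T \o S)) /\
                   'E_(P theta)[T \o S]%E = 0%E) ->
    forall theta, {ae P theta, forall w, T (S w) = 0}.

End Statistics.

(* Main.v *)
(** The void probabilities exp(- Lambda_g A) of the Poisson process carry the
    whole argument.  Up to null sets, the event {estimator >= u} says that no
    point lies below the graph of u, and Lambda_{max(g, u)}(A) is Lambda_g of
    the part of A above that graph; hence restricting P_g to
    {estimator >= u} gives a multiple of P_{max(g, u)}.  The sets {f | f >= u},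
    u in M, form a pi-system generating the sigma-algebra of M.

    Completeness: if T has mean zero under every P_{max(g, u)}, then it
    integrates to zero under P_g over all the events {estimator >= u}, hence
    over all events of the estimator.

    Sufficiency: let A lie below the height m and let h be the conditional
    probability, under a constant parameter c, that A contains no point, given
    the estimator truncated at height m.  Replacing g by min(g, m) changes
    neither P_g(no point in A) nor the law of the truncated estimator, and it
    makes P_g a multiple of a restriction of P_c, so h serves every g >= c, even
    when P_g is not dominated by P_c.  Versions for c = 0, -1, -2, ... are glued
    along the value of the estimator at 0.  A pi-lambda argument passes to the
    sigma-algebra generated by the avoidance events, and since the process is
    almost surely simple, this gives all the observed events up to null sets. *)

Require Import Defs.
From HB Require Import structures.
From mathcomp Require Import all_boot all_order all_algebra finmap.
From mathcomp Require Import all_classical all_reals all_analysis.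
From mathcomp Require Import measurable_realfun.
From mathcomp Require Import ring lra.

Set Implicit Arguments.
Unset Strict Implicit.
Unset Printing Implicit Defensive.

Import Order.TTheory GRing.Theory Num.Theory.
Import numFieldTopology.Exports numFieldNormedType.Exports.

Local Open Scope classical_set_scope.
Local Open Scope ring_scope.

(** * The class of increasing left-continuous functions *)

Section MonotoneFunctions.
Variable R : realType.
Implicit Types (f g u : mono R) (x y : unit_co R) (c : R).

Lemma unit_coP x : 0 <= \val x < 1.
Proof. by case: x => x /= /[!inE]. Qed.

Definition unit_co_pt (r : R) (hr : 0 <= r < 1) : unit_co R :=
  exist _ r (mem_set hr).

Lemma mono_le f x y : \val x <= \val y -> mono_eval f x <= mono_eval f y.
Proof. exact: monotone_increasing. Qed.

Lemma mono_ext f g : mono_eval f =1 mono_eval g -> f = g.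
Proof.
case: f => f f1 f2; case: g => g g1 g2 /funext/= fg.
rewrite /mono_eval /= in fg; subst g.
by rewrite (Prop_irrelevance f1 g1) (Prop_irrelevance f2 g2).
Qed.

(* For an increasing function, the points to the right of x impose nothing. *)
Definition left_lower_semicontinuous (h : unit_co R -> R) := forall x c, c < h x ->
  exists2 e, 0 < e & forall y, \val x - e < \val y -> c < h y.

(** Monotonicity bounds [h] above by [h x] to the left of [x], so only the lower bound in left
    continuity has content. This one-sided form is the one checked for maxima, minima, steps and the
    estimator. *)
Lemma left_continuous_lower_semicontinuousP (h : unit_co R -> R) : increasing h ->
  left_continuous h <-> left_lower_semicontinuous h.
Proof.
move=> ih; split=> [ch x c cx|ch x].
  have := ch x => /cvgrPdist_lt /(_ (h x - c)); rewrite subr_gt0 => /(_ cx).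
  rewrite near_withinE => /nbhs_ballP [e /= e0 he]; exists e => // y xy.
  have [xy'|yx] := ltP (\val y) (\val x); last exact: (lt_le_trans cx (ih _ _ yx)).
  have : `|h x - h y| < h x - c.
    apply: (he y _ xy') => //; change (ball (\val x) e (\val y)).
    rewrite -ball_normE /=.
    by rewrite ger0_norm ?subr_ge0 1?ltW// ltrBlDl -ltrBlDr.
  by rewrite ltr_norml => /andP[_]; rewrite ltrD2l ltrN2.
apply/cvgrPdist_lt => e e0.
have [|d d0 hd] := ch x (h x - e); first by rewrite ltrBlDl ltrDr.
rewrite near_withinE; apply/nbhs_ballP; exists d => //= y.
change (ball (\val x) d (\val y) -> \val y < \val x -> `|h x - h y| < e).
rewrite -ball_normE /= => xyd yx.
rewrite ger0_norm ?subr_ge0 ?ih// 1?ltW// ltrBlDl -ltrBlDr; apply: hd.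
by move: xyd; rewrite ger0_norm ?subr_ge0 1?ltW// ltrBlDl -ltrBlDr.
Qed.

Lemma mono_left_lower_semicontinuous f x c : c < mono_eval f x ->
  exists2 e, 0 < e & forall y, \val x - e < \val y -> c < mono_eval f y.
Proof.
case: f => f f1 f2; have /left_continuous_lower_semicontinuousP h := f1.
exact: (h.1 f2).
Qed.

Definition mono_of (h : unit_co R -> R) (ih : increasing h)
    (sh : left_lower_semicontinuous h) :
  mono R := MonotoneFun ih ((left_continuous_lower_semicontinuousP ih).2 sh).

Lemma join_increasing f g :
  increasing (fun x => Num.max (mono_eval f x) (mono_eval g x)).
Proof. by move=> x y xy; rewrite ge_max !le_max !mono_le //= orbT. Qed.

Lemma join_left_lower_semicontinuous f g :
  left_lower_semicontinuous (fun x => Num.max (mono_eval f x) (mono_eval g x)).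
Proof.
move=> x c; rewrite lt_max => /orP[] /mono_left_lower_semicontinuous[e e0 he];
  exists e => // y.
  by move=> /he cy; rewrite lt_max cy.
by move=> /he cy; rewrite lt_max cy orbT.
Qed.

Definition mono_join f g : mono R :=
  mono_of (@join_increasing f g) (@join_left_lower_semicontinuous f g).

Lemma cap_increasing (m : R) f : increasing (fun x => Num.min (mono_eval f x) m).
Proof.
by move=> x y xy; rewrite le_min !ge_min lexx orbT andbT mono_le.
Qed.

Lemma cap_left_lower_semicontinuous (m : R) f :
  left_lower_semicontinuous (fun x => Num.min (mono_eval f x) m).
Proof.
move=> x c; rewrite lt_min => /andP[/mono_left_lower_semicontinuous[e e0 he] cm].
by exists e => // y /he cy; rewrite lt_min cy.
Qed.

Definition mono_cap (m : R) f : mono R :=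
  mono_of (@cap_increasing m f) (@cap_left_lower_semicontinuous m f).

(** The step stands for the constraint [f >= c] to the right of [r] alone. Since the class is
    real-valued, minus infinity on the left is replaced by [K], later sent to it; the minimum with
    [c] keeps the step increasing for every [K]. *)
Lemma step_increasing (r c K : R) :
  increasing (fun x : unit_co R => if r < \val x then c else Num.min c K).
Proof.
move=> x y xy; case: ifPn => [rx|_]; first by rewrite (lt_le_trans rx xy).
by case: ifPn => // _; rewrite ge_min lexx.
Qed.

Lemma step_left_lower_semicontinuous (r c K : R) :
  left_lower_semicontinuous (fun x : unit_co R => if r < \val x then c else Num.min c K).
Proof.
move=> x a; case: ifPn => [rx ac|_].
  exists (\val x - r) => [|y]; first by rewrite subr_gt0.
  by rewrite subKr => ->.
rewrite lt_min => /andP[ac aK]; exists 1 => // y _; case: ifPn => // _.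
by rewrite lt_min ac.
Qed.

Definition mono_step (r c K : R) : mono R :=
  mono_of (@step_increasing r c K) (@step_left_lower_semicontinuous r c K).

Definition mono_cst (c : R) : mono R := mono_step 0 c c.

Lemma mono_cstE c x : mono_eval (mono_cst c) x = c.
Proof. by rewrite /mono_eval /=; case: ifP => // _; rewrite minxx. Qed.

Definition mono_leq f g := forall x, mono_eval f x <= mono_eval g x.

Lemma mono_leq_join f g u :
  mono_leq (mono_join f g) u <-> mono_leq f u /\ mono_leq g u.
Proof.
split=> [h|[hf hg] x]; last by rewrite /mono_eval /= ge_max hf hg.
by split=> x; have := h x; rewrite {1}/mono_eval /= ge_max => /andP[].
Qed.

Lemma mono_join_eqr f g : mono_leq f g -> mono_join f g = g.
Proof. by move=> fg; apply: mono_ext => x; exact: max_r. Qed.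

Definition unit_co0 : unit_co R.
Proof. by apply: (@unit_co_pt 0); rewrite lexx ltr01. Defined.

(* Rationals outside [0, 1) are sent to 0. *)
Definition rat_pt (q : rat) : unit_co R := insubd unit_co0 (ratr q).

Lemma rat_pt_dense (a b : R) : a < b -> 0 < b -> a < 1 ->
  exists q, a < \val (rat_pt q) < b.
Proof.
move=> ab b0 a1.
have /rat_in_itvoo[q] : Num.max a 0 < Num.min b 1 :> R.
  by rewrite gt_max !lt_min ab a1 b0 ltr01.
rewrite in_itv /= gt_max lt_min => /andP[/andP[aq q0] /andP[qb q1]].
have hq : ratr q \in unit_co R by rewrite inE /unit_co /= ltW.
by exists q; rewrite /rat_pt insubdK// aq.
Qed.

(** If [f x > g x] with [x > 0], then [f] still exceeds [g x] at some rational just left of [x],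
    where [g] is at most [g x]. The point 0 has no left neighbour, but is itself rational. *)
Lemma mono_leq_rat f g :
  (forall q, mono_eval f (rat_pt q) <= mono_eval g (rat_pt q)) -> mono_leq f g.
Proof.
move=> h x; have [x0|x0] := eqVneq (\val x) 0.
  have -> : x = rat_pt 0.
    apply: val_inj; rewrite x0 /rat_pt insubdK ?rmorph0//.
    by rewrite inE /unit_co /= lexx ltr01.
  exact: h.
have /andP[x0' x1] := unit_coP x.
rewrite leNgt; apply/negP => /mono_left_lower_semicontinuous[e e0 he].
have [|||q /andP[aq qb]] := @rat_pt_dense (\val x - e) (\val x).
- by rewrite ltrBlDr ltrDl.
- by rewrite lt_neqAle eq_sym x0.
- by rewrite (le_lt_trans _ x1)// gerBl ltW.
have := lt_le_trans (he _ aq) (h q).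
by rewrite ltNge (mono_le g (ltW qb)).
Qed.

Definition mono_upper u : set (mono R) := [set f | mono_leq u f].

Lemma measurable_eval x : measurable_fun setT (fun f : mono R => mono_eval f x).
Proof.
move=> _ B mB; rewrite setTI; apply: sub_sigma_algebra; exists x, B; split => //.
Qed.

Lemma mono_upperE u :
  mono_upper u =
  \bigcap_q [set f : mono R | mono_eval u (rat_pt q) <= mono_eval f (rat_pt q)].
Proof.
apply/seteqP; split => [f uf q _ /=|f uf]; first exact: uf.
by apply: mono_leq_rat => q; exact: uf.
Qed.

Lemma measurable_mono_upper u : measurable (mono_upper u).
Proof.
rewrite mono_upperE -[X in measurable X]setCK setC_bigcap; apply: measurableC.
apply: bigcupT_measurable_rat => q; apply: measurableC.
rewrite -[X in measurable X]setTI.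
have /(_ measurableT _ (measurable_itv `[mono_eval u (rat_pt q), +oo[)) :=
  @measurable_eval (rat_pt q).
by congr measurable; apply/seteqP; split => f /=; rewrite in_itv /= andbT.
Qed.

Definition upper_sets : set (set (mono R)) := range mono_upper.

Lemma upper_sets_setI : setI_closed upper_sets.
Proof.
move=> _ _ [f _ <-] [g _ <-]; exists (mono_join f g) => //.
by apply/seteqP; split => u; rewrite /mono_upper /setI /= => /mono_leq_join.
Qed.

Lemma mono_upper_step (r c K : R) f : mono_upper (mono_step r c K) f <->
  (forall x, r < \val x -> c <= mono_eval f x) /\
  (forall x, Num.min c K <= mono_eval f x).
Proof.
rewrite /mono_upper /= /mono_leq {1}/mono_eval /=; split=> [h|[h1 h2] x].
  split=> x => [rx|]; have := h x; first by rewrite rx.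
  by case: ifP => // _; apply: le_trans; rewrite ge_min lexx.
by case: ifP => [/h1|_].
Qed.

(* Approaching x from the left by rationals compensates for the left continuity
   of the steps: the condition f x >= c alone is not of the form u <= f. *)
Lemma mono_eval_geE x c : [set f : mono R | c <= mono_eval f x] =
  \bigcap_l \bigcup_K \bigcup_(q in [set q : rat | ratr q < \val x])
    mono_upper (mono_step (ratr q) (c - l.+1%:R^-1) (- K%:R)).
Proof.
have [x0 x1] : 0 <= \val x /\ \val x < 1 by apply/andP/unit_coP.
apply/seteqP; split=> [f /= cf l _|f h /=].
  have [|e e0 he] := @mono_left_lower_semicontinuous f x (c - l.+1%:R^-1).
    by rewrite (lt_le_trans _ cf)// ltrBlDr ltrDl invr_gt0.
  have [q] : exists q : rat, ratr q \in `](\val x - e), (\val x)[%R.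
    by apply: rat_in_itvoo; rewrite ltrBlDr ltrDl.
  rewrite in_itv /= => /andP[xq qx].
  (* An increasing function is bounded below by its value at 0. *)
  exists (Num.bound (mono_eval f unit_co0)) => //; exists q => //.
  apply/mono_upper_step; split=> y.
    by move=> qy; apply: ltW; apply: he; rewrite (lt_trans xq).
  rewrite ge_min; apply/orP; right.
  apply: (@le_trans _ _ (mono_eval f unit_co0)); last first.
    by apply: mono_le; have /andP[] := unit_coP y.
  by rewrite lerNl ltW// unstable.ltrNbound.
rewrite leNgt; apply/negP => /ltr_add_invr[l fl].
have [K _ [q /= qx /mono_upper_step[+ _]]] := h l I.
by move=> /(_ _ qx); rewrite lerBlDr leNgt fl.
Qed.

Lemma measurable_upper_sets : @measurable _ (mono R) = <<s upper_sets >>.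
Proof.
apply/seteqP; split; last first.
  apply: smallest_sub; first exact: sigma_algebra_measurable.
  by move=> _ [u _ <-]; exact: measurable_mono_upper.
apply: smallest_sub; first exact: smallest_sigma_algebra.
move=> _ [x [B [mB ->]]].
pose ev (f : g_sigma_algebraType upper_sets) : measurableTypeR R :=
  mono_eval (f : mono R) x.
suff mev : measurable_fun setT ev.
  by have := mev measurableT B mB; rewrite setTI.
apply: (measurability (@RGenCInfty.G R)) => [|_ [_ [c ->] <-]].
  exact: RGenCInfty.measurableE.
rewrite setTI.
have -> : ev @^-1` `[c, +oo[ = [set f : mono R | c <= mono_eval f x].
  by apply/seteqP; split => f /=; rewrite in_itv /= andbT.
rewrite mono_eval_geE.
apply: (bigcap_measurableType (T := g_sigma_algebraType upper_sets)) => l _.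
apply: bigcup_measurable => K _; rewrite bigcup_mkcond.
apply: bigcupT_measurable_rat => q; case: ifPn => // _.
by apply: sub_sigma_algebra; eexists.
Qed.

Lemma measurable_mono d (T : measurableType d) (F : T -> mono R) :
  (forall x, measurable_fun setT (fun w => mono_eval (F w) x)) ->
  measurable_fun setT F.
Proof.
move=> mF.
apply: (@measurability _ _ _ _ setT F (@point_evaluations R)) =>
  [|_ [_ [x [B [mB ->]]] <-]]; first by [].
by have := mF x measurableT B mB.
Qed.

Lemma measurable_mono_cap (m : R) : measurable_fun setT (mono_cap m).
Proof.
apply: measurable_mono => x.
exact: measurable_minr (@measurable_eval x) (measurable_cst m).
Qed.

Lemma mono_upper_cap (m : R) u f : mono_leq u (mono_cap m f) <->
  mono_leq u f /\ forall x, mono_eval u x <= m.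
Proof.
split=> [h|[h1 h2] x]; last by rewrite /mono_eval /= le_min h1 h2.
by split=> x; have := h x; rewrite {2}/mono_eval /= le_min => /andP[].
Qed.

Lemma bigcup_mono_upper :
  \bigcup_k mono_upper (mono_cst (- k%:R)) = [set: mono R].
Proof.
apply/seteqP; split=> // f _.
exists (Num.bound (mono_eval f unit_co0)) => // x.
rewrite mono_cstE; apply: (@le_trans _ _ (mono_eval f unit_co0)); last first.
  by apply: mono_le; have /andP[] := unit_coP x.
by rewrite lerNl ltW// unstable.ltrNbound.
Qed.

(** Uniqueness on a generating pi-system. The whole space need not be an upper set, so it is
    exhausted by the upper sets of the constants [- k]. *)
Lemma mono_measure_unique (m1 m2 : {measure set (mono R) -> \bar R}) :
  (forall u, m1 (mono_upper u) = m2 (mono_upper u)) ->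
  (forall u, m1 (mono_upper u) < +oo)%E ->
  forall B, measurable B -> m1 B = m2 B.
Proof.
move=> m12 m1y; apply: (measure_unique upper_sets (fun k => mono_upper (mono_cst (- k%:R)))).
- exact: measurable_upper_sets.
- exact: upper_sets_setI.
- by move=> k; eexists.
- exact: bigcup_mono_upper.
- by move=> _ [u _ <-].
- by move=> k; exact: m1y.
Qed.

End MonotoneFunctions.

(** * The intensity measure *)

Section Intensity.
Variable R : realType.
Implicit Types (f g u : mono R) (x y : unit_co R) (c : R).

Local Notation plane := (measurableTypeR R * measurableTypeR R)%type.
Local Notation area := (lebesgue_measure \x lebesgue_measure)%E.

Definition epigraph g : set plane :=
  [set p | exists2 x, \val x = p.1 & mono_eval g x <= p.2].

Definition hypograph g : set plane :=
  [set p | exists2 x, \val x = p.1 & p.2 < mono_eval g x].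

Definition left_of (a : R) : set plane := [set p | p.1 < a].
Definition below (c : R) : set plane := [set p | p.2 < c].

Lemma measurable_left_of a : measurable (left_of a).
Proof.
have := @measurable_fst _ _ (measurableTypeR R) (measurableTypeR R) measurableT
  _ (measurable_itv `]-oo, a[).
by rewrite setTI; congr measurable.
Qed.

Lemma measurable_below c : measurable (below c).
Proof.
have := @measurable_snd _ _ (measurableTypeR R) (measurableTypeR R) measurableT
  _ (measurable_itv `]-oo, c[).
by rewrite setTI; congr measurable.
Qed.

(** A countable description, for measurability: each rational [q] to the left of the point, or at
    its abscissa, requires [g q] to be at most the ordinate. Left lower semicontinuity passes from
    the rationals to the abscissa. *)
Lemma epigraphE g : epigraph g = (left_of 1 `&` ~` left_of 0) `&`
  \bigcap_q (left_of (\val (rat_pt R q)) `|` ~` below (mono_eval g (rat_pt R q))).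
Proof.
apply/seteqP; split => [p [x xp gxp]|p [[p1 /negP]]].
  have /andP[x0 x1] := unit_coP x.
  split; first by split; [rewrite /left_of /= -xp|apply/negP; rewrite -leNgt -xp].
  move=> q _; rewrite /left_of /below /= -xp.
  have [|qx] := ltP (\val x) (\val (rat_pt R q)); first by left.
  by right; apply/negP; rewrite -leNgt (le_trans (mono_le g qx)).
rewrite /left_of /= -leNgt => p0 h.
have hp : 0 <= p.1 < 1 by rewrite p0.
exists (unit_co_pt hp) => //.
have hq q : \val (rat_pt R q) <= p.1 -> mono_eval g (rat_pt R q) <= p.2.
  move=> qp; have [|/negP] := h q I; first by rewrite /left_of /= ltNge qp.
  by rewrite /below /= -leNgt.
rewrite leNgt; apply/negP => pg.
have [e e0 he] := mono_left_lower_semicontinuous pg; rewrite /= in he.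
have [p10|p10] := eqVneq p.1 0.
  have E : \val (rat_pt R 0) = 0.
    rewrite /rat_pt insubdK ?rmorph0//.
    by rewrite inE /unit_co /= lexx ltr01.
  have := he (rat_pt R 0); rewrite p10 E ltrBlDr add0r e0 => /(_ isT).
  by rewrite ltNge hq// E p0.
have [|||q /andP[aq qb]] := @rat_pt_dense R (p.1 - e) p.1.
- by rewrite ltrBlDr ltrDl.
- by rewrite lt_neqAle eq_sym p10.
- by rewrite (le_lt_trans _ p1)// gerBl ltW.
by have := he _ aq; rewrite ltNge hq// ltW.
Qed.

Lemma measurable_epigraph g : measurable (epigraph g).
Proof.
rewrite epigraphE; apply: measurableI.
  apply: measurableI; first exact: measurable_left_of.
  by apply: measurableC; exact: measurable_left_of.
rewrite -[X in measurable X]setCK setC_bigcap; apply: measurableC.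
apply: bigcupT_measurable_rat => q; apply: measurableC.
apply: measurableU; first exact: measurable_left_of.
by apply: measurableC; exact: measurable_below.
Qed.

Lemma hypographE g :
  hypograph g = (left_of 1 `&` ~` left_of 0) `\` epigraph g.
Proof.
apply/seteqP; split => [p [x xp pgx]|p [[p1 /negP p0] hp]].
  have /andP[x0 x1] := unit_coP x.
  split; first by split; [rewrite /left_of /= -xp|apply/negP; rewrite -leNgt -xp].
  move=> [y yp]; rewrite leNgt => /negP; apply.
  by rewrite (_ : y = x)//; apply: val_inj; rewrite xp yp.
rewrite /left_of /= -leNgt in p0 p1.
have h : 0 <= p.1 < 1 by rewrite p0.
exists (unit_co_pt h) => //.
by rewrite ltNge; apply/negP => gp; apply: hp; exists (unit_co_pt h).
Qed.

Lemma measurable_hypograph g : measurable (hypograph g).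
Proof.
rewrite hypographE; apply: measurableD; last exact: measurable_epigraph.
apply: measurableI; first exact: measurable_left_of.
by apply: measurableC; exact: measurable_left_of.
Qed.

Lemma intensityE (n : R) g (p : plane) :
  intensity n g p = n * \1_(epigraph g) p.
Proof.
rewrite /intensity indicE; case: insubP => [x xp xE|xp].
  congr (_ * (nat_of_bool _)%:R); apply/idP/idP => [gx|/set_mem[y yp]].
    by apply/mem_set; exists x.
  by rewrite (_ : y = x)//; apply: val_inj; rewrite xE.
rewrite memNset ?mulr0// => -[y yp _].
by move/negP: xp; apply; rewrite -yp; exact: valP.
Qed.

Variables (n : R) (hn : 1 <= n).
Local Notation Lam := (intensity_measure n).

Lemma rate_gt0 : 0 < n. Proof. exact: lt_le_trans hn. Qed.
Lemma rate_ge0 : 0 <= n. Proof. exact: ltW rate_gt0. Qed.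

Lemma intensity_measureE g A : measurable A ->
  Lam g A = (n%:E * area (A `&` epigraph g))%E.
Proof.
move=> mA; rewrite /intensity_measure.
under eq_integral do rewrite intensityE EFinM.
rewrite ge0_integralZl//=.
- by rewrite integral_indic 1?setIC//; exact: measurable_epigraph.
- apply/measurable_EFinP; apply: measurable_funTS.
  by apply: measurable_indic; exact: measurable_epigraph.
- by rewrite lee_fin rate_ge0.
Qed.

Lemma intensity_measure_ge0 g A : measurable A -> (0 <= Lam g A)%E.
Proof.
by move=> mA; rewrite intensity_measureE// mule_ge0 ?lee_fin ?rate_ge0.
Qed.


(** The union is split asymmetrically so that, for [A] a hypograph, the second term is the one
    rewritten by [intensity_measure_join]. *)
Lemma intensity_measureU g A B : measurable A -> measurable B ->
  Lam g (A `|` B) = (Lam g A + Lam g (B `\` A))%E.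
Proof.
move=> mA mB; have mE := measurable_epigraph g.
rewrite intensity_measureE ?intensity_measureE//; [|exact: measurableD|exact: measurableU].
have area_split (mu : {measure set plane -> \bar R}) (E : set plane) :
    measurable E ->
    mu ((A `|` B) `&` E) = (mu (A `&` E) + mu ((B `\` A) `&` E))%E.
  move=> mE'; rewrite -measureU.
  - congr (mu _); rewrite -setIUl; congr (_ `&` _).
    apply/seteqP; split=> p; last by case=> [Ap|[Bp _]]; [left|right].
    by case=> [Ap|Bp]; [left|have [Ap|nAp] := pselect (A p); [left|right]].
  - exact: measurableI.
  - by apply: measurableI => //; exact: measurableD.
  - by apply/seteqP; split=> p // [[Ap _] [[_ /(_ Ap)]]].
rewrite area_split// ge0_muleDr//; exact: measure_ge0.
Qed.

(** Over [0, 1), the complement of the hypograph of [u] is its epigraph, and the epigraphs of [g]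
    and [u] meet in that of their maximum. *)
Lemma intensity_measure_join g u A : measurable A ->
  Lam g (A `\` hypograph u) = Lam (mono_join g u) A.
Proof.
move=> mA; have mD : measurable (A `\` hypograph u).
  by apply: measurableD => //; exact: measurable_hypograph.
rewrite (intensity_measureE _ mA) (intensity_measureE _ mD).
congr (_ * area _)%E; apply/seteqP; split => p.
  move=> [[Ap hp] [x xp gx]]; split => //; exists x => //.
  rewrite /mono_eval /= ge_max gx/= leNgt; apply/negP => up.
  by apply: hp; exists x.
move=> [Ap [x xp]]; rewrite {1}/mono_eval /= ge_max => /andP[gx ux].
split; [split => // -[y yp]|by exists x].
by rewrite (_ : y = x) 1?ltNge ?ux//; apply: val_inj; rewrite xp yp.
Qed.

Lemma intensity_measure_cap g (m : R) A : measurable A -> A `<=` below m ->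
  Lam (mono_cap m g) A = Lam g A.
Proof.
move=> mA Am; rewrite !(intensity_measureE _ mA).
congr (_ * area _)%E; apply/seteqP; split => p [Ap [x xp gx]]; split => //.
  exists x => //; move: gx; rewrite {1}/mono_eval /= ge_min => /orP[//|].
  by rewrite leNgt Am.
by exists x => //; rewrite /mono_eval /= ge_min gx.
Qed.

Lemma intensity_measure_eq0 g A : measurable A ->
  (forall p, A p -> ~ epigraph g p) -> Lam g A = 0%E.
Proof.
move=> mA h; rewrite intensity_measureE// (_ : _ `&` _ = set0) ?measure0 ?mule0//.
by apply/seteqP; split => // p [/h].
Qed.

(** On [[b, c]] with [c < 1] the function is at most [g c], so the strip contains a rectangle of
    positive width and infinite height inside the epigraph. Hence points almost surely occur
    arbitrarily close to the line x = 1. *)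
Lemma intensity_measure_strip g (a : R) : a < 1 ->
  Lam g (~` left_of a) = +oo%E.
Proof.
move=> a1; rewrite intensity_measureE; last first.
  by apply: measurableC; exact: measurable_left_of.
pose b := Num.max a 0; pose c := (b + 1) / 2.
have b1 : b < 1 by rewrite /b gt_max a1 ltr01.
have bc : b < c by rewrite /c; lra.
have c1 : c < 1 by rewrite /c; lra.
have b0 : 0 <= b by rewrite /b le_max lexx orbT.
have hc : 0 <= c < 1 by rewrite c1 andbT; lra.
pose x := unit_co_pt hc.
suff : (+oo <= area (~` left_of a `&` epigraph g))%E.
  by rewrite leye_eq => /eqP ->; rewrite gt0_muley// lte_fin rate_gt0.
apply: (@le_trans _ _ (area (`[b, c] `*` `[mono_eval g x, +oo[))).
  rewrite product_measure1E// [X in (_ <= X * _)%E](lebesgue_measure_itv `[b, c]).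
  rewrite [X in (_ <= _ * X)%E](lebesgue_measure_itv `[mono_eval g x, +oo[).
  rewrite /= lte_fin bc ltry.
  by rewrite addye// gt0_muley// -EFinB lte_fin subr_gt0.
apply: le_measure; rewrite ?inE.
- exact: measurableX.
- apply: measurableI; last exact: measurable_epigraph.
  by apply: measurableC; exact: measurable_left_of.
move=> p [/=]; rewrite !in_itv /= andbT => /andP[bp pc] gp.
split; first by apply/negP; rewrite -leNgt (le_trans _ bp)// /b le_max lexx.
have hp : 0 <= p.1 < 1 by rewrite (le_trans b0 bp) (le_lt_trans pc c1).
by exists (unit_co_pt hp) => //; rewrite (le_trans _ gp)// mono_le.
Qed.

Lemma area_rectangle (a b c e : R) : a <= b -> c <= e ->
  area (`[a, b] `*` `[c, e]) = ((b - a) * (e - c))%:E.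
Proof.
have itvE (x y : R) : x <= y -> lebesgue_measure (`[x, y]%classic : set R) = (y - x)%:E.
  rewrite lebesgue_measure_itv/= lte_fin le_eqVlt => /orP[/eqP->|->//].
  by rewrite ltxx subrr.
by move=> ab ce; rewrite product_measure1E// [X in (X * _)%E]itvE// [X in (_ * X)%E]itvE.
Qed.

Lemma intensity_measure_rectangle g (a b c e : R) A : a <= b -> c <= e ->
  measurable A -> A `&` epigraph g `<=` `[a, b] `*` `[c, e] ->
  (Lam g A <= (n * ((b - a) * (e - c)))%:E)%E.
Proof.
move=> ab ce mA Aab; rewrite intensity_measureE// EFinM lee_wpmul2l ?lee_fin ?rate_ge0//.
rewrite -area_rectangle//; apply: le_measure; rewrite ?inE//.
- by apply: measurableI => //; exact: measurable_epigraph.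
- exact: measurableX.
Qed.

(** Ensures that the factor exp(- Lambda_c(hypograph u)) is positive, so that it can be cancelled.
    The region charged lies between the heights [c] and [max c m]. *)
Lemma intensity_measure_hypograph_lty u (c m : R) :
  (forall x, mono_eval u x <= m) ->
  (Lam (mono_cst c) (hypograph u) < +oo)%E.
Proof.
move=> um; apply: le_lt_trans (ltry _).
apply: (@intensity_measure_rectangle _ 0 1 c (Num.max c m)) => //.
- by rewrite le_max lexx.
- exact: measurable_hypograph.
move=> p [[x xp pu] [y _ cp]]; split; rewrite /= in_itv /= -?xp.
  by have /andP[-> /ltW ->] := unit_coP x.
by rewrite mono_cstE in cp; rewrite cp le_max (le_trans (ltW pu) (um x)) orbT.
Qed.

Lemma intensity_measure_hypograph0 g : Lam g (hypograph g) = 0%E.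
Proof.
apply: intensity_measure_eq0; first exact: measurable_hypograph.
by move=> p; rewrite hypographE => -[].
Qed.

End Intensity.

(** * Avoidance events and the estimator *)

Section PointProcess.
Variables (R : realType) (d : measure_display) (Omega : measurableType d).
Variable xi : nat -> Omega -> measurableTypeR R * measurableTypeR R.
Hypothesis hxi : point_process xi.

Local Notation plane := (measurableTypeR R * measurableTypeR R)%type.

Definition avoids (A : set plane) : set Omega := [set w | forall j, ~ A (xi j w)].

Lemma avoidsU A B : avoids (A `|` B) = avoids A `&` avoids B.
Proof.
apply/seteqP; split => [w h|w [hA hB] j []]; [|exact: hA|exact: hB].
by split => j ?; apply: (h j); [left|right].
Qed.

Lemma avoids_subset A B : A `<=` B -> avoids B `<=` avoids A.
Proof. by move=> AB w h j /AB; exact: h. Qed.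

Lemma count_eq0 A w : (Defs.count xi A w == 0%E) = (w \in avoids A).
Proof.
apply/eqP/idP => [c0|/set_mem h]; last first.
  by apply: eseries0 => j _ _; rewrite diracE memNset//; exact: h.
apply/mem_set => j Aj.
have : (\d_(xi j w) A <= Defs.count xi A w)%E.
  apply: le_trans (nneseries_lim_ge j.+1 _) => //.
  by rewrite big_nat_recr//= leeDr// sume_ge0.
by rewrite c0 diracE mem_set// leNgt lte_fin ltr01.
Qed.

Lemma avoidsE A : avoids A = Defs.count xi A @^-1` [set 0%:R%:E].
Proof.
apply/seteqP; split => w /=.
  by move=> h; apply/eqP; rewrite count_eq0; apply/mem_set.
by move=> /eqP; rewrite count_eq0 => /set_mem.
Qed.

Lemma measurable_count A : measurable A -> measurable_fun setT (Defs.count xi A).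
Proof.
have [mxi _ _] := hxi.
move=> mA; apply: ge0_emeasurable_sum => j.
  by move=> *; exact: measure_ge0.
move=> _; rewrite [X in measurable_fun _ X](_ : _ = EFin \o (\1_A \o xi j)); last first.
  by apply/funext => w; rewrite /= diracE indicE.
by apply/measurable_EFinP; apply: measurableT_comp => //; exact: mxi.
Qed.

Lemma measurable_avoids A : measurable A -> measurable (avoids A).
Proof.
move=> mA; rewrite avoidsE -[X in measurable X]setTI.
exact: measurable_count.
Qed.

Definition count_events : set (set Omega) :=
  [set E | exists (A : set plane) (B : set (\bar R)),
         [/\ measurable A, measurable B & E = Defs.count xi A @^-1` B]].

Lemma observed_avoids A : measurable A -> observed_events xi (avoids A).
Proof.
move=> mA; apply: sub_sigma_algebra.
by exists A, [set 0%:R%:E]; split => //; rewrite avoidsE.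
Qed.

Lemma observed_measurable E : observed_events xi E -> measurable E.
Proof.
move: E; apply: smallest_sub; first exact: sigma_algebra_measurable.
move=> _ [A [B [mA mB ->]]]; rewrite -[X in measurable X]setTI.
exact: measurable_count.
Qed.

(** Points no higher than a given one have ordinates in a bounded interval, so local finiteness
    leaves finitely many candidates. *)
Lemma points_min_exists (J : set nat) w c : J !=set0 -> avoids (below c) w ->
  exists2 i, J i & forall j, J j -> (xi i w).2 <= (xi j w).2.
Proof.
move=> [j0 Jj0] hc; have [_ _ /(_ w) fin] := hxi.
have hcj j : c <= (xi j w).2 by rewrite leNgt; apply/negP/hc.
pose b := Num.max `|(xi j0 w).2| `|c|.
have /finite_fsetP[X XE] := fin b.
have JX j : `|(xi j w).2| <= b -> j \in X by move=> jb; have : [set` X] j by rewrite -XE.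
have j0X : j0 \in X by apply: JX; rewrite /b le_max lexx.
have Pj0 : `[< J (val [` j0X]%fset) >] by apply/asboolP.
case: (@arg_minP _ _ _ [` j0X]%fset (fun i : X => `[< J (val i) >])
  (fun i : X => (xi (val i) w).2) Pj0) => i /asboolP Ji hi.
exists (val i) => // j Jj; have [jX|jX] := boolP (j \in X).
  by apply: (hi [` jX]%fset); apply/asboolP.
apply: le_trans (hi [` j0X]%fset Pj0) _ => /=.
rewrite leNgt; apply/negP => jj0; move/negP: jX; apply; apply: JX.
rewrite /b ler_norml le_max; apply/andP; split.
  rewrite lerNl le_max; apply/orP; right.
  by rewrite -normrN (le_trans _ (ler_norm _))// lerN2.
by apply/orP; left; rewrite (le_trans (ltW jj0))// ler_norm.
Qed.

(** The ordinates are bounded below, and abscissas reach beyond every level less than 1. This is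
    exactly when the estimator is a genuine one ([mle_exists], [mle_min_exists]); written with
    avoidance events, it is visibly observed. *)
Definition min_exists : set Omega :=
  \bigcup_k avoids (below (- k%:R)) `&`
  \bigcap_k ~` avoids (~` left_of (1 - k.+1%:R^-1)).

Lemma points_is_min w (x : unit_co R) : min_exists w ->
  exists v, is_min [set (xi i w).2 | i in [set i | \val x <= (xi i w).1]] v.
Proof.
move=> [[k _ hk] hq].
have /andP[x0 x1] := unit_coP x.
have [q xq] := ltr_add_invr x1.
have [j hj] : exists j, ~ left_of (1 - q.+1%:R^-1) (xi j w).
  by have := hq q I; apply: contra_notP => /forallNP.
have [|i xi_i hi] := @points_min_exists [set i | \val x <= (xi i w).1] w _ _ hk.
  by exists j; move/negP: hj; rewrite -leNgt => /=; apply: le_trans; rewrite lerBrDr ltW.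
by exists (xi i w).2; split=> [|_ [j' xj' <-]]; [exists i|exact: hi].
Qed.

Lemma mle_exists w : min_exists w -> exists m, is_mon_mle (xi ^~ w) m.
Proof.
move=> gw.
have /choice[h hh] := fun x => @points_is_min w x gw.
have ih : increasing h.
  move=> x y xy; have [[i yi <-] _] := hh y; have [_] := hh x.
  by apply; exists i => //=; exact: le_trans yi.
have sh : left_lower_semicontinuous h.
  move=> x c cx; case: gw => -[k _ hk] _.
  (* As the minimum at [x] exceeds [c], all points of height at most [c] lie left of [x]. They are
     finitely many, and the distance from [x] to the rightmost of them serves as radius; if there
     are none, any radius does. *)
  pose J := [set j | (xi j w).2 <= c /\ (xi j w).1 < \val x].
  have [[j0 Jj0]|J0] := pselect (J !=set0); last first.
    exists 1 => // y _; rewrite ltNge; apply/negP => yc.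
    have [[i yi hi] _] := hh y.
    apply: J0; exists i; split; first by rewrite hi.
    rewrite ltNge; apply/negP => xi_i; have [_ /(_ (xi i w).2)] := hh x.
    by rewrite leNgt hi (le_lt_trans yc cx) => hF; suff : false by []; apply: hF; exists i.
  have [_ _ /(_ w) fin] := hxi.
  have /finite_fsetP[X XE] := fin (Num.max `|c| k%:R).
  have JX j : J j -> j \in X.
    move=> [jc _]; suff : [set` X] j by []; rewrite -XE /=.
    have kj : - k%:R <= (xi j w).2 by rewrite leNgt; apply/negP/hk.
    rewrite ler_norml; apply/andP; split.
      by rewrite (le_trans _ kj)// lerN2 le_max lexx orbT.
    by rewrite le_max (le_trans jc)// ler_norm.
  have Pj0 : `[< J (val [` JX _ Jj0]%fset) >] by apply/asboolP.
  case: (@arg_maxP _ _ _ [` JX _ Jj0]%fset (fun i : X => `[< J (val i) >])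
    (fun i : X => (xi (val i) w).1) Pj0) => i /asboolP[_ xi_i] hi.
  exists (\val x - (xi (val i) w).1); first by rewrite subr_gt0.
  move=> y; rewrite subKr => iy.
  rewrite ltNge; apply/negP => yc; have [[j yj hj] _] := hh y.
  have Jj : J j.
    split; first by rewrite hj.
    rewrite ltNge; apply/negP => xj; have [_ /(_ (xi j w).2)] := hh x.
    by rewrite leNgt hj (le_lt_trans yc cx) => hF; suff : false by []; apply: hF; exists j.
  have /asboolP/(hi [` JX _ Jj]%fset) /= : J j by [].
  by rewrite leNgt (lt_le_trans iy yj).
exists (mono_of ih sh) => x; exact: hh.
Qed.

Lemma mon_mleP w : min_exists w -> is_mon_mle (xi ^~ w) (mon_mle xi w).
Proof. by move=> /mle_exists[m hm]; exact: xgetPex (ex_intro _ m hm). Qed.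

(** All abscissas are nonnegative, so the value of [m] at 0 bounds every ordinate below; the minimum
    at 1 - 1/(k+1) is attained by a point at or to the right of it. *)
Lemma mle_min_exists w m : is_mon_mle (xi ^~ w) m -> min_exists w.
Proof.
move=> hm; split.
  exists (Num.bound (mono_eval m (unit_co0 R))) => //  j.
  have [_ /(_ (xi j w).2)] := hm (unit_co0 R).
  have [_ /(_ j w)/andP[x0 _] _] := hxi.
  have : [set (xi i w).2 | i in [set i | 0 <= (xi i w).1]] (xi j w).2 by exists j.
  move=> /[swap] /[apply] mj /=; rewrite /below /= ltNge => /negP; apply.
  by rewrite (le_trans _ mj)// lerNl ltW// unstable.ltrNbound.
move=> k _ hv.
have hk : 0 <= (1 - k.+1%:R^-1 : R) < 1.
  by rewrite subr_ge0 invf_le1 ?ler1n//= gtrBl invr_gt0.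
have [[i qi _] _] := hm (unit_co_pt hk).
by apply: (hv i); apply/negP; rewrite -leNgt.
Qed.

Lemma mon_mle_out w : ~ min_exists w -> mon_mle xi w = point.
Proof.
move=> gw; rewrite /mon_mle xgetPN// => m hm.
by apply: gw; exact: mle_min_exists hm.
Qed.

Variables (n : R) (hn : 1 <= n).
Variable P : mono R -> probability Omega R.
Hypothesis hP : forall g, poisson_process (P g) (intensity_measure n g) xi.

(** For finite intensity this is the Poisson weight at 0. For infinite intensity the count is almost
    surely infinite and [expeR] of minus infinity is 0. *)
Lemma P_avoids g A : measurable A ->
  P g (avoids A) = expeR (- intensity_measure n g A).
Proof.
move=> mA; have [h1 h2 _] := hP g.
have := intensity_measure_ge0 hn g mA.
case E : (intensity_measure n g A) => [r| |//] _.
  have := h1 A mA; rewrite E => /(_ (ltry _) 0%N).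
  by rewrite -avoidsE => ->; rewrite expr0 mulr1 fact0 divr1.
have h := h2 A mA E.
have mC : measurable (Defs.count xi A @^-1` [set +oo%E]).
  by rewrite -[X in measurable X]setTI; exact: measurable_count.
apply: (@subset_measure0 _ _ _ (P g) _ (~` (Defs.count xi A @^-1` [set +oo%E]))).
- exact: measurable_avoids.
- exact: measurableC.
- by rewrite avoidsE => w /= ->.
- by have /= -> := probability_setC (P g) mC; rewrite h subee.
Qed.

End PointProcess.

(** * Measurability of the estimator and its joint void probabilities *)

Section Estimator.
Variables (R : realType) (d : measure_display) (Omega : measurableType d).
Variable xi : nat -> Omega -> measurableTypeR R * measurableTypeR R.
Hypothesis hxi : point_process xi.

Local Notation plane := (measurableTypeR R * measurableTypeR R)%type.
Local Notation S := (mon_mle xi : Omega -> mono R).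
Local Notation Obs := (g_sigma_algebraType (count_events xi)).

Lemma observed_min_exists : @measurable _ Obs (min_exists xi).
Proof.
apply: measurableI.
  by apply: bigcup_measurable => k _; apply: observed_avoids; exact: measurable_below.
apply: (bigcap_measurableType (T := Obs)) => k _; apply: measurableC.
by apply: observed_avoids; apply: measurableC; exact: measurable_left_of.
Qed.

Lemma mon_mle_geP w x c : min_exists xi w ->
  c <= mono_eval (S w) x <-> avoids xi (~` left_of (\val x) `&` below c) w.
Proof.
move=> /(mon_mleP hxi)/(_ x)[[i xi_i <-] hi]; split => [ci j [/negP]|h].
  rewrite /left_of /= -leNgt => xj; rewrite /below /= ltNge => /negP; apply.
  by rewrite (le_trans ci)// hi//; exists j.
rewrite leNgt; apply/negP => ic; apply: (h i); split => //.
by apply/negP; rewrite -leNgt.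
Qed.

Lemma measurable_mon_mle_obs : measurable_fun setT (S : Obs -> mono R).
Proof.
apply: measurable_mono => x.
apply: (measurability (@RGenCInfty.G R)) => [|_ [_ [c ->] <-]].
  exact: RGenCInfty.measurableE.
(* Off [min_exists] the estimator is the constant [point], so the event splits into an avoidance
   event and a trivial one. *)
rewrite setTI [X in measurable X](_ : _ =
  (min_exists xi `&` avoids xi (~` left_of (\val x) `&` below c)) `|`
  (~` min_exists xi `&` [set _ | c <= mono_eval (point : mono R) x])).
  apply: measurableU; first apply: measurableI.
  - exact: observed_min_exists.
  - apply: observed_avoids; apply: measurableI; last exact: measurable_below.
    by apply: measurableC; exact: measurable_left_of.
  - apply: measurableI; first by apply: measurableC; exact: observed_min_exists.
    rewrite (_ : [set _ | _] =
        if c <= mono_eval (point : mono R) x then setT else set0).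
      by case: ifP.
    by apply/seteqP; split=> w /=; case: ifP.
apply/seteqP; split => w /=; rewrite in_itv /= andbT.
  have [gw|gw] := pselect (min_exists xi w).
    by move=> /(mon_mle_geP _ _ gw); left.
  by rewrite mon_mle_out// => ?; right.
by move=> [[gw] /(mon_mle_geP _ _ gw)//|[gw]]; rewrite mon_mle_out.
Qed.

Lemma statistic_mon_mle : statistic (observed_events xi) S.
Proof.
by move=> B mB; have := measurable_mon_mle_obs measurableT mB; rewrite setTI.
Qed.

Lemma measurable_mon_mle : measurable_fun setT S.
Proof.
move=> _ B mB; rewrite setTI; apply: (observed_measurable hxi).
exact: statistic_mon_mle.
Qed.

Lemma measurable_min_exists : measurable (min_exists xi).
Proof. exact: (observed_measurable hxi) observed_min_exists. Qed.

(* A point on the line x = 1 enters the estimator but lies in no hypograph. *)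
Definition regular : set Omega := min_exists xi `&` avoids xi (~` left_of 1).

Lemma measurable_regular : measurable regular.
Proof.
apply: measurableI; first exact: measurable_min_exists.
by apply: (measurable_avoids hxi); apply: measurableC; exact: measurable_left_of.
Qed.

(** A point below the graph of [u] pulls the minimum at its own abscissa below [u]. Conversely, the
    minimum at [x] is attained at some abscissa in [x, 1), where the ordinate is at least [u] there,
    hence at least [u x]. *)
Lemma regular_upper u w : regular w ->
  mono_leq u (S w) <-> avoids xi (hypograph u) w.
Proof.
move=> [gw h1]; have hm := mon_mleP hxi gw; split=> [uS j [x xj ux]|h x].
  have [_ /(_ (xi j w).2)] := hm x.
  rewrite leNgt (lt_le_trans ux (uS x)) => hF; suff : false by [].
  by apply: hF; exists j => //=; rewrite xj.
have [[i xi_i <-] _] := hm x.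
have [_ /(_ i w)/andP[i0 _] _] := hxi.
have hi : 0 <= (xi i w).1 < 1.
  by rewrite i0 ltNge; apply/negP => i1; apply: (h1 i); apply/negP; rewrite -leNgt.
rewrite leNgt; apply/negP => iu; apply: (h i).
by exists (unit_co_pt hi) => //; rewrite (lt_le_trans iu)// mono_le.
Qed.

Variables (n : R) (hn : 1 <= n).
Variable P : mono R -> probability Omega R.
Hypothesis hP : forall g, poisson_process (P g) (intensity_measure n g) xi.
Local Notation Lam := (intensity_measure n).

Lemma not_avoids_null g A : measurable A -> Lam g A = 0%E -> P g (~` avoids xi A) = 0%E.
Proof.
move=> mA A0; have /= -> := probability_setC (P g) (measurable_avoids hxi mA).
by rewrite (P_avoids hxi hn hP)// A0 oppe0 expeR0 subee.
Qed.

(** The region below a constant under [g] at 0 has no mass, every strip to the right of a level less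
    than 1 has infinite mass, and the half-plane x >= 1 has no mass. *)
Lemma not_regular_null g : P g (~` regular) = 0%E.
Proof.
have strip a : measurable (~` @left_of R a).
  by apply: measurableC; exact: measurable_left_of.
rewrite /regular /min_exists !setCI setC_bigcap.
have [k hk] : exists k, - k%:R <= mono_eval g (unit_co0 R).
  exists (Num.bound (mono_eval g (unit_co0 R))).
  by rewrite lerNl ltW// unstable.ltrNbound.
have N1 : (P g).-negligible (~` \bigcup_k0 avoids xi (below (- k0%:R))).
  apply: (negligibleS (A := ~` avoids xi (below (- k%:R)))).
    by apply: subsetC => w hw; exists k.
  apply/negligibleP.
    by apply: measurableC; apply: (measurable_avoids hxi); exact: measurable_below.
  apply: not_avoids_null; first exact: measurable_below.
  apply: (intensity_measure_eq0 hn); first exact: measurable_below.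
  move=> p + [x _]; rewrite /below /= => pk.
  rewrite leNgt (lt_le_trans pk)// (le_trans hk)// mono_le//.
  by have /andP[] := unit_coP x.
have N2 : (P g).-negligible (\bigcup_k ~` ~` avoids xi (~` left_of (1 - k.+1%:R^-1))).
  apply: negligible_bigcup => q; rewrite setCK.
  apply/negligibleP; first exact: (measurable_avoids hxi).
  have /= -> := P_avoids hxi hn hP g (strip (1 - q.+1%:R^-1)).
  by rewrite intensity_measure_strip// gtrBl invr_gt0.
have N3 : (P g).-negligible (~` avoids xi (~` left_of 1)).
  apply/negligibleP.
    by apply: measurableC; exact: (measurable_avoids hxi).
  apply: not_avoids_null => //; apply: (intensity_measure_eq0 hn) => // p p1 [x xp _].
  by apply: p1; rewrite /left_of /= -xp; have /andP[] := unit_coP x.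
apply: measure_negligible.
  rewrite -setC_bigcap -!setCI; apply: measurableC; exact: measurable_regular.
by apply: negligibleU => //; exact: negligibleU.
Qed.

Lemma P_regular_eq g E E' : measurable E -> measurable E' ->
  (forall w, regular w -> E w <-> E' w) -> P g E = P g E'.
Proof.
suff le E1 E2 : measurable E1 -> measurable E2 ->
    (forall w, regular w -> E1 w -> E2 w) -> (P g E1 <= P g E2)%E.
  move=> mE mE' EE'; apply/eqP; rewrite eq_le.
  by apply/andP; split; apply: le => // w /EE'[].
have mR := measurableC measurable_regular.
move=> mE1 mE2 E12; rewrite -(measureU0 mE2 mR (not_regular_null g)).
apply: le_measure; [exact/mem_set|exact/mem_set/measurableU|].
by move=> w E1w; have [/E12 h|] := pselect (regular w); [left; exact: h|right].
Qed.

Lemma measurable_mle_upper u : measurable (S @^-1` mono_upper u).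
Proof.
rewrite -[X in measurable X]setTI; apply: measurable_mon_mle => //.
exact: measurable_mono_upper.
Qed.

(** Up to a null set the event says that [hypograph u] and [A] are both avoided. The exponent splits
    into the mass of the hypograph and that of the rest of [A], which is the mass of [A] under the
    maximum. *)
Lemma P_avoids_upper_expeR g u A : measurable A ->
  P g (avoids xi A `&` S @^-1` mono_upper u) =
  (expeR (- Lam g (hypograph u)) * P (mono_join g u) (avoids xi A))%E.
Proof.
move=> mA; have mU := measurable_hypograph u.
rewrite (@P_regular_eq _ _ (avoids xi (hypograph u `|` A))).
- rewrite !(P_avoids hxi hn hP)//; last exact: measurableU.
  rewrite intensity_measureU// intensity_measure_join//.
  rewrite oppeD ?expeRD//.
  by rewrite ge0_adde_def// inE intensity_measure_ge0.
- by apply: measurableI; [exact: (measurable_avoids hxi)|exact: measurable_mle_upper].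
- by apply: (measurable_avoids hxi); exact: measurableU.
- move=> w rw; rewrite avoidsU; split => -[h1 h2]; split => //.
    exact/(regular_upper _ rw).
  exact/(regular_upper _ rw).
Qed.

End Estimator.

(** * Image measures, densities and clipping *)

Section MeasureTools.
Context d (T : measurableType d) (R : realType).
Implicit Type mu : {measure set T -> \bar R}.

Section Push.
Context d' (T' : measurableType d') (mu : {measure set T -> \bar R}).
Variables (f : T -> T') (mf : measurable_fun setT f).

Definition push : {measure set T' -> \bar R}.
Proof. unshelve refine (pushforward mu f : {measure set T' -> \bar R}); exact: mf. Defined.

Lemma pushE B : push B = mu (f @^-1` B). Proof. by []. Qed.

Lemma integral_push B (phi : T' -> \bar R) : measurable B ->
  measurable_fun setT phi -> (forall x, 0 <= phi x)%E ->
  (\int[push]_(x in B) phi x = \int[mu]_(x in f @^-1` B) phi (f x))%E.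
Proof.
move=> mB mphi phi0.
rewrite -[RHS](ge0_integral_pushforward mf mu mB)//; exact: measurable_funTS.
Qed.

End Push.

Section Density.
Variables (mu : {measure set T -> \bar R}) (phi : T -> \bar R).
Hypotheses (mphi : measurable_fun setT phi) (phi0 : forall x, (0 <= phi x)%E).

Definition density_fun (B : set T) : \bar R := (\int[mu]_(x in B) phi x)%E.

Let density_fun0 : density_fun set0 = 0%E.
Proof. exact: integral_set0. Qed.

Let density_fun_ge0 B : (0 <= density_fun B)%E.
Proof. by apply: integral_ge0 => x _; exact: phi0. Qed.

HB.instance Definition _ := isMeasure.Build _ _ _ density_fun
  density_fun0 density_fun_ge0 (semi_sigma_additive_nng_induced mphi phi0).

Definition density : {measure set T -> \bar R} := density_fun.

Lemma densityE B : density B = (\int[mu]_(x in B) phi x)%E. Proof. by []. Qed.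

End Density.

Definition clip (phi : T -> \bar R) (x : T) : R := fine (mine (phi x) 1%E).

Lemma clip_bounds phi x : (0 <= phi x)%E -> 0 <= clip phi x <= 1.
Proof.
move=> p0; have h0 : (0 <= mine (phi x) 1)%E by rewrite le_min p0 lee01.
have h1 : (mine (phi x) 1 <= 1)%E by rewrite ge_min lexx orbT.
rewrite /clip; case: (mine _ _) h0 h1 => // r /=.
by rewrite !lee_fin => -> ->.
Qed.

Lemma clipE phi x : (0 <= phi x)%E -> (clip phi x)%:E = mine (phi x) 1%E.
Proof.
move=> p0; have h0 : (0 <= mine (phi x) 1)%E by rewrite le_min p0 lee01.
have h1 : (mine (phi x) 1 <= 1)%E by rewrite ge_min lexx orbT.
by rewrite /clip fineK// fin_numElt (lt_le_trans _ h0)//= (le_lt_trans h1)// ltry.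
Qed.

Lemma measurable_clip phi : measurable_fun setT phi ->
  measurable_fun setT (clip phi).
Proof.
move=> mphi; apply: measurableT_comp; first exact: fine_measurable.
exact: measurable_mine.
Qed.

(** On a set where [phi] is at least 1 + 1/(k+1), the integral would exceed the measure unless that
    set is null. So [phi] is at most 1 almost everywhere, and clipping changes it only on a null
    set. *)
Lemma integral_clip mu phi : (mu setT < +oo)%E ->
  measurable_fun setT phi -> (forall x, 0 <= phi x)%E ->
  (forall B, measurable B -> \int[mu]_(x in B) phi x <= mu B)%E ->
  forall B, measurable B ->
  (\int[mu]_(x in B) phi x = \int[mu]_(x in B) (clip phi x)%:E)%E.
Proof.
move=> muy mphi phi0 hphi B mB.
pose D k := [set x | (1 + k.+1%:R^-1)%:E <= phi x]%E.
have mD k : measurable (D k).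
  by rewrite -[D k]setTI; exact: emeasurable_fun_c_infty.
have D0 k : mu (D k) = 0%E.
  apply/eqP; rewrite eq_le measure_ge0 andbT leNgt; apply/negP => Dgt0.
  have Dfin : mu (D k) \is a fin_num.
    rewrite ge0_fin_numE//; apply: le_lt_trans muy.
    by apply: le_measure => //; exact/mem_set.
  have : ((1 + k.+1%:R^-1)%:E * mu (D k) <= mu (D k))%E.
    apply: le_trans (hphi _ (mD k)).
    rewrite -integral_cst//; apply: ge0_le_integral => //=.
    exact: measurable_funTS.
  move: Dfin Dgt0; case: (mu (D k)) => // r _; rewrite lte_fin => r0.
  by rewrite -EFinM lee_fin mulrDl mul1r gerDl leNgt mulr_gt0.
apply: ge0_ae_eq_integral => //.
- exact: measurable_funTS.
- apply/measurable_EFinP; apply: measurable_funTS; exact: measurable_clip.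
- by move=> x _; have /andP[] := clip_bounds (phi0 x); rewrite lee_fin.
have : mu.-negligible (\bigcup_k D k).
  apply: negligible_bigcup => k.
  by apply/negligibleP; [exact: mD|exact: D0].
apply: negligibleS => x /= /not_implyP[_].
rewrite clipE//; case: leP => // phi1 _.
move: phi1; rewrite /D; case E : (phi x) => [r| |]//.
  rewrite lte_fin => /ltr_add_invr[k hk]; exists k => //=.
  by rewrite E lee_fin ltW.
by move=> _; exists 0%N => //=; rewrite E leey.
Qed.

(** The clipped density is real and lies in [0, 1] everywhere, not just almost everywhere, as is
    wanted of conditional probabilities. *)
Lemma radon_nikodym_le mu (nu : {measure set T -> \bar R}) :
  (mu setT < +oo)%E ->
  (forall B, measurable B -> nu B <= mu B)%E ->
  exists h : T -> R, [/\ measurable_fun setT h, forall x, 0 <= h x <= 1 &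
    forall B, measurable B -> nu B = (\int[mu]_(x in B) (h x)%:E)%E].
Proof.
move=> muy numu.
have nuy : (nu setT < +oo)%E by apply: le_lt_trans (numu _ _) muy.
pose mu' : {finite_measure set T -> \bar R} := mfrestr measurableT muy.
pose nu' : {finite_measure set T -> \bar R} := mfrestr measurableT nuy.
have mu'E B : mu' B = mu B by rewrite /mu' /= /mfrestr /mrestr setIT.
have nu'E B : nu' B = nu B by rewrite /nu' /= /mfrestr /mrestr setIT.
have dom : nu' `<< mu'.
  apply/null_content_dominatesP => B mB muB; apply: etrans (nu'E B) _.
  have muB0 : mu B = 0%E by rewrite -mu'E.
  by apply/eqP; rewrite eq_le measure_ge0 andbT -muB0; exact: numu.
have [phi [phi0 iphi nuE]] := radon_nikodym_finite dom.
have mphi : measurable_fun setT phi by case/integrableP : iphi.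
exists (clip phi); split => [|x|B mB]; [exact: measurable_clip|exact: clip_bounds|].
have nuI C : measurable C -> nu C = (\int[mu]_(x in C) phi x)%E.
  move=> mC; rewrite -nu'E nuE//; apply: eq_measure_integral => D mD _.
  exact: mu'E.
rewrite -integral_clip//; first exact: nuI.
by move=> C mC; rewrite -nuI// numu.
Qed.

End MeasureTools.

(** * Change of parameter and completeness *)

Section ChangeOfParameter.
Variables (R : realType) (d : measure_display) (Omega : measurableType d).
Variable xi : nat -> Omega -> measurableTypeR R * measurableTypeR R.
Hypothesis hxi : point_process xi.
Variables (n : R) (hn : 1 <= n).
Variable P : mono R -> probability Omega R.
Hypothesis hP : forall g, poisson_process (P g) (intensity_measure n g) xi.

Local Notation plane := (measurableTypeR R * measurableTypeR R)%type.
Local Notation S := (mon_mle xi : Omega -> mono R).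
Local Notation Lam := (intensity_measure n).
Local Notation mS := (measurable_mon_mle hxi).

Lemma measurable_mle_preimage B : measurable B -> measurable (S @^-1` B).
Proof. by move=> mB; rewrite -[X in measurable X]setTI; exact: mS. Qed.

Definition law g : {measure set (mono R) -> \bar R} := push (P g) mS.

Definition joint_law g E (mE : measurable E) : {measure set (mono R) -> \bar R} :=
  push (mrestr (P g) mE) mS.

Lemma law_setT g : law g setT = 1%E.
Proof. exact: (probability_setT (P g)). Qed.

Lemma law_lty g B : measurable B -> (law g B < +oo)%E.
Proof.
move=> mB; apply: le_lt_trans (ltry 1); rewrite -(law_setT g).
by apply: le_measure => //; exact/mem_set.
Qed.

Lemma joint_lawE g E (mE : measurable E) B :
  joint_law g mE B = P g (E `&` S @^-1` B).
Proof. by rewrite /joint_law pushE /mrestr /= setIC. Qed.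

Lemma avoids0 : avoids xi set0 = setT.
Proof. by apply/seteqP; split => // w _ j []. Qed.

(** The probability under [g] that the estimator is at least [u] (see [law_upper]), packaged as a
    nonnegative real so that it can scale a measure; it is 0 when the hypograph has infinite
    mass. *)
Definition weight g u : {nonneg R} :=
  NngNum (fine_ge0 (expeR_ge0 (- Lam g (hypograph u)))).

Lemma weightE g u : (weight g u)%:num%:E = expeR (- Lam g (hypograph u)).
Proof.
have := intensity_measure_ge0 hn g (measurable_hypograph u).
by rewrite /=; case: (Lam _ _) => //=.
Qed.

Lemma P_avoids_upper g u A : measurable A ->
  P g (avoids xi A `&` S @^-1` mono_upper u) =
  ((weight g u)%:num%:E * P (mono_join g u) (avoids xi A))%E.
Proof. by move=> mA; rewrite weightE (P_avoids_upper_expeR hxi hn hP). Qed.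

Lemma law_upper g u : law g (mono_upper u) = (weight g u)%:num%:E.
Proof.
have := P_avoids_upper g u (@measurable0 _ plane).
rewrite avoids0 setTI => h; apply: (etrans h).
by have /= -> := probability_setT (P (mono_join g u)); rewrite mule1.
Qed.

(** Both sides are measures in [B], so upper sets suffice. There the event that the estimator is at
    least [v] is absorbed by enlarging [A] with [hypograph v], and the case without [B] applies. *)
Lemma P_avoids_restrict g u A B : measurable A -> measurable B ->
  P g (avoids xi A `&` S @^-1` (B `&` mono_upper u)) =
  ((weight g u)%:num%:E * P (mono_join g u) (avoids xi A `&` S @^-1` B))%E.
Proof.
move=> mA mB.
have mvA := measurable_avoids hxi mA.
have mE : measurable (avoids xi A `&` S @^-1` mono_upper u).
  by apply: measurableI => //; exact: measurable_mle_upper.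
pose m1 := joint_law g mE.
pose m2 : {measure set (mono R) -> \bar R} :=
  mscale (weight g u) (joint_law (mono_join g u) mvA).
have m2E C : m2 C = ((weight g u)%:num%:E *
    P (mono_join g u) (avoids xi A `&` S @^-1` C))%E.
  by rewrite -(joint_lawE _ mvA).
have m1E C : m1 C = P g (avoids xi A `&` S @^-1` (C `&` mono_upper u)).
  by rewrite /m1 joint_lawE preimage_setI -setIA [in LHS](setIC (S @^-1` mono_upper u)).
rewrite -m1E -m2E; apply: mono_measure_unique => // v; last first.
  by rewrite m1E; apply: le_lt_trans (probability_le1 _ _) (ltry 1);
    apply: measurableI => //; apply: measurable_mle_preimage; apply: measurableI;
    exact: measurable_mono_upper.
have mH := measurable_hypograph v.
have regE h C : measurable C ->
    P h (avoids xi (A `|` hypograph v) `&` S @^-1` C) =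
    P h (avoids xi A `&` S @^-1` (mono_upper v `&` C)).
  move=> mC; apply: (P_regular_eq hxi hn hP).
  - apply: measurableI; last exact: measurable_mle_preimage.
    by apply: (measurable_avoids hxi); exact: measurableU.
  - apply: measurableI => //; apply: measurable_mle_preimage.
    by apply: measurableI => //; exact: measurable_mono_upper.
  - move=> w rw; rewrite avoidsU.
    split; [move=> [[a b] c]|move=> [a [b c]]]; split => //; split => //.
      exact/(regular_upper hxi _ rw).
    exact/(regular_upper hxi _ rw).
rewrite m1E -regE; last exact: measurable_mono_upper.
rewrite P_avoids_upper; last exact: measurableU.
rewrite m2E; congr (_ * _)%E.
by have := regE (mono_join g u) setT measurableT; rewrite preimage_setT !setIT.
Qed.

Lemma law_restrict g u B : measurable B ->
  law g (B `&` mono_upper u) = ((weight g u)%:num%:E * law (mono_join g u) B)%E.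
Proof.
move=> mB; have := P_avoids_restrict g u (@measurable0 _ plane) mB.
by rewrite avoids0 !setTI.
Qed.

Lemma integral_law_restrict g u B (phi : mono R -> \bar R) :
  measurable B -> B `<=` mono_upper u ->
  measurable_fun setT phi -> (forall f, 0 <= phi f)%E ->
  (\int[law g]_(f in B) phi f =
   (weight g u)%:num%:E * \int[law (mono_join g u)]_(f in B) phi f)%E.
Proof.
move=> mB Bu mphi phi0.
rewrite -ge0_integral_mscale//; last exact: measurable_funTS.
apply: eq_measure_integral => C mC CB.
by rewrite -[C in LHS](setIidl (subset_trans CB Bu)) law_restrict.
Qed.

(** The hypograph of the true parameter carries no intensity, so the estimator almost surely
    dominates the parameter, here the maximum of [g] and [u]. *)
Lemma law_upper_self g u : law (mono_join g u) (~` mono_upper u) = 0%E.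
Proof.
have mU := measurable_mono_upper u.
have mUj := measurable_mono_upper (mono_join g u).
apply: (@subset_measure0 _ _ _ _ _ (~` mono_upper (mono_join g u))) => //.
- exact: measurableC.
- exact: measurableC.
- by apply: subsetC => f /mono_leq_join[].
change (P (mono_join g u) (~` (S @^-1` mono_upper (mono_join g u))) = 0%E).
have /= -> := probability_setC (P (mono_join g u)) (measurable_mle_preimage mUj).
have h := law_upper (mono_join g u) (mono_join g u).
rewrite weightE intensity_measure_hypograph0// oppe0 expeR0 in h.
rewrite -[X in (_ - X)%E]/(law (mono_join g u) (mono_upper (mono_join g u))) h.
by rewrite subee.
Qed.

Lemma integral_law_upper g u (phi : mono R -> \bar R) :
  measurable_fun setT phi -> (forall f, 0 <= phi f)%E ->
  (\int[law g]_(f in mono_upper u) phi f =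
   (weight g u)%:num%:E * \int[law (mono_join g u)]_f phi f)%E.
Proof.
move=> mphi phi0; have mU := measurable_mono_upper u.
rewrite (integral_law_restrict _ (u := u))//; congr (_ * _)%E.
rewrite [RHS](ge0_negligible_integral _ _ _ _ (law_upper_self g u))//.
  by rewrite setTD setCK.
exact: measurableC.
Qed.

End ChangeOfParameter.

(** * Completeness of the estimator *)

Section Completeness.
Variables (R : realType) (d : measure_display) (Omega : measurableType d).
Variable xi : nat -> Omega -> measurableTypeR R * measurableTypeR R.
Hypothesis hxi : point_process xi.
Variables (n : R) (hn : 1 <= n).
Variable P : mono R -> probability Omega R.
Hypothesis hP : forall g, poisson_process (P g) (intensity_measure n g) xi.

Local Notation S := (mon_mle xi : Omega -> mono R).
Local Notation mS := (measurable_mon_mle hxi).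
Local Notation law := (law hxi P).

Lemma integral_law g B (phi : mono R -> \bar R) : measurable B ->
  measurable_fun setT phi -> (forall f, 0 <= phi f)%E ->
  (\int[law g]_(f in B) phi f = \int[P g]_(w in S @^-1` B) phi (S w))%E.
Proof. by move=> mB mphi phi0; rewrite /law integral_push. Qed.

(** The uniqueness argument is for nonnegative measures, so the mean-zero condition is restated as
    equality of the integrals of the two parts, both finite. *)
Lemma unbiased_zero_parts (T : mono R -> R) g : measurable_fun setT T ->
  (P g).-integrable setT (EFin \o (T \o S)) -> 'E_(P g)[T \o S]%E = 0%E ->
  (\int[law g]_f (EFin \o T)^\+ f = \int[law g]_f (EFin \o T)^\- f)%E /\
  (\int[law g]_f (EFin \o T)^\+ f < +oo)%E.
Proof.
move=> mT iT ET0.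
have E0 : (\int[P g]_w (EFin \o (T \o S)) w)%E = 0%E by rewrite -ET0 unlock.
rewrite integralE in E0.
have mT' : measurable_fun setT (EFin \o T) by exact/measurable_EFinP.
have fp : (\int[P g]_w (EFin \o (T \o S))^\+ w < +oo)%E.
  exact: integral_funepos_lt_pinfty.
have fn : (\int[P g]_w (EFin \o (T \o S))^\- w < +oo)%E.
  exact: integral_funeneg_lt_pinfty.
have mpos := measurable_funepos mT'; have mneg := measurable_funeneg mT'.
rewrite (integral_law g measurableT mpos (funepos_ge0 _)).
rewrite (integral_law g measurableT mneg (funeneg_ge0 _)).
rewrite preimage_setT.
have ep : (\int[P g]_w (EFin \o T)^\+ (S w) = \int[P g]_w (EFin \o (T \o S))^\+ w)%E.
  by apply: eq_integral => w _; rewrite !funeposE.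
have en : (\int[P g]_w (EFin \o T)^\- (S w) = \int[P g]_w (EFin \o (T \o S))^\- w)%E.
  by apply: eq_integral => w _; rewrite !funenegE.
rewrite ep en; split => //.
move: E0 fp fn => /=.
have p0 : (0 <= \int[P g]_w (EFin \o (T \o S))^\+ w)%E by exact: integral_ge0.
have n0 : (0 <= \int[P g]_w (EFin \o (T \o S))^\- w)%E by exact: integral_ge0.
move=> E0 fp fn; move: E0 p0 fp n0 fn.
case: (\int[P g]_w _)%E => // a; case: (\int[P g]_w _)%E => // b.
by move=> + _ _ _ _; rewrite -EFinB => -[/eqP]; rewrite subr_eq0 => /eqP ->.
Qed.

Lemma complete_mon_mle : complete_statistic P S.
Proof.
move=> T mT hT g.
have mT' : measurable_fun setT (EFin \o T) by exact/measurable_EFinP.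
have mpos := measurable_funepos mT'; have mneg := measurable_funeneg mT'.
pose m1 := density (law g) mpos (funepos_ge0 (EFin \o T)).
pose m2 := density (law g) mneg (funeneg_ge0 (EFin \o T)).
have parts h := unbiased_zero_parts mT (hT h).1 (hT h).2.
have m12 : forall B, measurable B -> m1 B = m2 B.
  apply: mono_measure_unique => u; rewrite /m1 /m2 !densityE !(integral_law_upper hxi hn hP)//.
    by rewrite (parts (mono_join g u)).1.
  by rewrite lte_mul_pinfty ?lee_fin// (parts (mono_join g u)).2.
(* The densities of [m1] and [m2] have disjoint supports: [m2] vanishes on [B] and [m1] off [B].
   Being equal, both are zero. *)
pose B : set (mono R) := [set f | 0 < T f].
have mB : measurable B.
  have := mT measurableT _ (measurable_itv `]0, +oo[); rewrite setTI.
  by congr measurable; apply/seteqP; split => f /=; rewrite in_itv /= andbT.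
have m1T : m1 setT = 0%E.
  have mBC := measurableC mB.
  have e1 : m1 B = 0%E.
    rewrite m12// /m2 densityE integral0_eq// => f /= Tf.
    by rewrite funenegE; apply/max_idPr; rewrite lee_fin oppr_le0 ltW.
  have e2 : m1 (~` B) = 0%E.
    rewrite /m1 densityE integral0_eq// => f /= /negP.
    by rewrite -leNgt funeposE => Tf; apply/max_idPr; rewrite lee_fin.
  have := measureU m1 mB mBC (setICr B); rewrite setUv => h.
  by apply: (etrans h); rewrite -[LHS]/(m1 B + m1 (~` B))%E e1 e2 adde0.
have m2T : m2 setT = 0%E by rewrite -m12.
have : (\int[P g]_w `|(EFin \o (T \o S)) w|)%E = 0%E.
  transitivity (m1 setT + m2 setT)%E; last by rewrite m1T m2T adde0.
  rewrite /m1 /m2 !densityE (integral_law g measurableT mpos (funepos_ge0 _)).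
  rewrite (integral_law g measurableT mneg (funeneg_ge0 _)) preimage_setT -ge0_integralD//.
  - by apply: eq_integral => w _; have /funeqP/(_ (S w)) := fune_abse (EFin \o T).
  - exact: measurableT_comp mpos mS.
  - exact: measurableT_comp mneg mS.
move=> /(ae_eq_integral_abs (P g) measurableT
  (measurableT_comp mT' mS)).1; apply: filterS => w /= /(_ I).
by move=> [].
Qed.

End Completeness.

(** * Conditional probabilities of avoidance events *)

Section AvoidanceVersions.
Variables (R : realType) (d : measure_display) (Omega : measurableType d).
Variable xi : nat -> Omega -> measurableTypeR R * measurableTypeR R.
Hypothesis hxi : point_process xi.
Variables (n : R) (hn : 1 <= n).
Variable P : mono R -> probability Omega R.
Hypothesis hP : forall g, poisson_process (P g) (intensity_measure n g) xi.

Local Notation plane := (measurableTypeR R * measurableTypeR R)%type.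
Local Notation S := (mon_mle xi : Omega -> mono R).
Local Notation mS := (measurable_mon_mle hxi).
Local Notation law := (law hxi P).
Local Notation Lam := (intensity_measure n).
Local Notation weight := (weight n).

Lemma preimage_cap_upper (m : R) (u : mono R) : (forall x, mono_eval u x <= m) ->
  mono_cap m @^-1` mono_upper u = mono_upper u.
Proof.
by move=> um; apply/seteqP; split=> f /= => [/mono_upper_cap[]|uf]//; apply/mono_upper_cap.
Qed.

(** The truncated estimator dominates [u] only if [u] is at most [m], and then exactly when the
    estimator does. The probability involves the mass of a region below height [m], which is the
    same for [g] and its truncation. *)
Lemma law_cap g m B : measurable B ->
  law (mono_cap m g) (mono_cap m @^-1` B) = law g (mono_cap m @^-1` B).
Proof.
have mcap := @measurable_mono_cap R m.
apply: (@mono_measure_unique _ (push (law (mono_cap m g)) mcap) (push (law g) mcap)).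
  move=> u; change (law (mono_cap m g) (mono_cap m @^-1` mono_upper u) =
    law g (mono_cap m @^-1` mono_upper u)).
  have [um|um] := pselect (forall x, mono_eval u x <= m); last first.
    rewrite (_ : _ @^-1` _ = set0) ?measure0//.
    by apply/seteqP; split=> f //= /mono_upper_cap[].
  rewrite preimage_cap_upper// !(law_upper hxi hn hP) !weightE//.
  rewrite intensity_measure_cap//; first exact: measurable_hypograph.
  by move=> p [x _ px]; rewrite /below /= (lt_le_trans px).
move=> u; apply: (law_lty hxi P (mono_cap m g) (B := mono_cap m @^-1` mono_upper u)).
rewrite -[X in measurable X]setTI; apply: mcap => //.
exact: measurable_mono_upper.
Qed.

(** The density is built under the constant [c] alone. It is first shown to have the right total
    mass for every [g >= c]; this extends to all [B] because restricting to an upper set leads to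
    [max(g, u)], again above [c]. *)
Lemma avoids_version_ge A (m c : R) : measurable A -> A `<=` below m -> c <= m ->
  exists h : mono R -> R, [/\ measurable_fun setT h, forall f, 0 <= h f <= 1 &
    forall g, mono_leq (mono_cst c) g -> forall B, measurable B ->
      P g (avoids xi A `&` S @^-1` B) = (\int[law g]_(f in B) (h f)%:E)%E].
Proof.
move=> mA Am cm; have mvA := measurable_avoids hxi mA.
have mcap := @measurable_mono_cap R m.
have mpre B : measurable B -> measurable (mono_cap m @^-1` B).
  by move=> mB; rewrite -[X in measurable X]setTI; exact: mcap.
have [|B mB|h0 [mh0 h01 h0E]] := @radon_nikodym_le _ _ _
  (push (law (mono_cst c)) mcap)
  (push (joint_law hxi P (mono_cst c) mvA) mcap).
- by apply: (law_lty hxi P (mono_cst c) (B := mono_cap m @^-1` setT)); exact: mpre measurableT.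
- change (joint_law hxi P (mono_cst c) mvA (mono_cap m @^-1` B) <=
    law (mono_cst c) (mono_cap m @^-1` B))%E.
  rewrite joint_lawE.
  have mSB := measurable_mle_preimage hxi (mpre _ mB).
  apply: le_measure; [apply/mem_set; exact: measurableI|exact/mem_set|].
  exact: subIsetr.
pose h f := h0 (mono_cap m f).
have mh : measurable_fun setT h by exact: measurableT_comp mh0 mcap.
have mhE : measurable_fun setT (EFin \o h) by exact/measurable_EFinP.
have hge f : (0 <= (EFin \o h) f)%E.
  by rewrite lee_fin; have /andP[] := h01 (mono_cap m f).
have hint g : (\int[law g]_f (h f)%:E =
    \int[push (law g) mcap]_f (h0 f)%:E)%E.
  rewrite integral_push ?preimage_setT//; first exact/measurable_EFinP.
  by move=> f; rewrite lee_fin; have /andP[] := h01 f.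
have unbiased g : mono_leq (mono_cst c) g ->
    P g (avoids xi A) = (\int[law g]_f (h f)%:E)%E.
  move=> cg; pose g' := mono_cap m g.
  have cg' : mono_join (mono_cst c) g' = g'.
    apply: mono_join_eqr => x; rewrite mono_cstE /mono_eval /= le_min cm andbT.
    by have := cg x; rewrite mono_cstE.
  have g'm x : mono_eval g' x <= m by rewrite /mono_eval /= ge_min lexx orbT.
  have wgt0 : (0 < (weight (mono_cst c) g')%:num%:E)%E.
    rewrite weightE// expeR_gt0//.
    have := intensity_measure_hypograph_lty hn c g'm.
    have := intensity_measure_ge0 hn (mono_cst c) (measurable_hypograph g').
    by case: (intensity_measure _ _ _) => // r _ _; rewrite -EFinN ltNyr.
  have -> : P g (avoids xi A) = P g' (avoids xi A).
    by rewrite !(P_avoids hxi hn hP)// intensity_measure_cap.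
  have -> : (\int[law g]_f (h f)%:E = \int[law g']_f (h f)%:E)%E.
    rewrite !hint; apply: eq_measure_integral => B mB _.
    exact: esym (law_cap g m mB).
  (* Both sides are quantities under the constant [c] on the event that the estimator is at least
     [g']. As [g'] is at most [m], this event depends on the truncated estimator only, so the
     defining property of [h0] equates them. *)
  have : ((weight (mono_cst c) g')%:num%:E * P g' (avoids xi A) =
      (weight (mono_cst c) g')%:num%:E * \int[law g']_f (h f)%:E)%E.
    have := P_avoids_upper hxi hn hP (mono_cst c) g' mA; rewrite cg' => <-.
    have := integral_law_upper hxi hn hP (mono_cst c) g' mhE hge; rewrite cg' => <-.
    have : joint_law hxi P (mono_cst c) mvA (mono_cap m @^-1` mono_upper g') = _ :=
      h0E _ (measurable_mono_upper g').
    rewrite joint_lawE preimage_cap_upper// => ->.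
    rewrite integral_push//.
    - by rewrite preimage_cap_upper.
    - exact: measurable_mono_upper.
    - exact/measurable_EFinP.
    - by move=> f; rewrite lee_fin; have /andP[] := h01 f.
  move=> wE; apply/eqP; rewrite eq_le.
  have wfin : (weight (mono_cst c) g')%:num%:E \is a fin_num by [].
  by rewrite -(lee_pmul2l wfin wgt0) wE lexx -(lee_pmul2l wfin wgt0) wE lexx.
exists h; split => // [f|g cg B mB]; first exact: h01.
have := @mono_measure_unique _ (joint_law hxi P g mvA) (density (law g) mhE hge).
rewrite -(joint_lawE hxi P g mvA) => H; apply: H => // u.
  rewrite joint_lawE densityE (P_avoids_upper hxi hn hP)//.
  rewrite (integral_law_upper hxi hn hP)// unbiased// => x.
  by rewrite /mono_eval /= le_max cg.
rewrite joint_lawE; apply: le_lt_trans (probability_le1 _ _) (ltry 1).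
by apply: measurableI => //; exact: measurable_mle_upper.
Qed.

End AvoidanceVersions.

(** * Versions common to all parameters, and their closure properties *)

Section CommonVersions.
Variables (R : realType) (d : measure_display) (Omega : measurableType d).
Variable xi : nat -> Omega -> measurableTypeR R * measurableTypeR R.
Hypothesis hxi : point_process xi.
Variables (n : R) (hn : 1 <= n).
Variable P : mono R -> probability Omega R.
Hypothesis hP : forall g, poisson_process (P g) (intensity_measure n g) xi.

Local Notation plane := (measurableTypeR R * measurableTypeR R)%type.
Local Notation S := (mon_mle xi : Omega -> mono R).
Local Notation mS := (measurable_mon_mle hxi).
Local Notation law := (law hxi P).

Definition common_version E (h : mono R -> R) :=
  [/\ measurable_fun setT h, forall f, 0 <= h f <= 1 &
    forall g B, measurable B ->
      P g (E `&` S @^-1` B) = (\int[law g]_(f in B) (h f)%:E)%E].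

(** The space is cut into the layers of functions above [- k] but not above [- k + 1], with [h_ k]
    used on layer [k]. Restricted to that layer, the law under any [g] is a multiple of the one
    under [max(g, - k)], for which [h_ k] is valid. *)
Lemma avoids_version A (m : R) : measurable A -> A `<=` below m ->
  exists h, common_version (avoids xi A) h.
Proof.
move=> mA Am; have mvA := measurable_avoids hxi mA.
(* Raising the height to at least 0 makes every constant [- k] admissible. *)
have Am' : A `<=` below (Num.max m 0).
  by move=> p /Am pm; rewrite /below /= lt_max pm.
have hk k : - k%:R <= Num.max m 0 :> R by rewrite le_max oppr_le0 ler0n orbT.
have /choice[h_ hh] := fun k => avoids_version_ge hxi hn hP mA Am' (hk k).
pose D k := mono_upper (mono_cst (- k%:R : R)).
have mD k : measurable (D k) by exact: measurable_mono_upper.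
pose D' := seqDU D.
have mD' k : measurable (D' k) by exact: seqDU_measurable.
have tD' : trivIset setT D' by exact: trivIset_seqDU.
have D'T : \bigcup_k D' k = setT by rewrite -seqDU_bigcup_eq bigcup_mono_upper.
have /choice[idx hidx] : forall f, exists k, D' k f.
  by move=> f; have : [set: mono R] f by []; rewrite -D'T => -[k _ Dk]; exists k.
have idxE k f : D' k f -> idx f = k.
  by move=> Dkf; apply: (tD' _ _ I I); exists f.
pose h f := h_ (idx f) f.
have h01 f : 0 <= h f <= 1 by have [_ h1 _] := hh (idx f); exact: h1.
have mh : measurable_fun setT h.
  rewrite -D'T; apply/measurable_fun_bigcup => // k.
  apply: (@eq_measurable_fun _ _ _ _ _ (h_ k)).
    by move=> f /set_mem /idxE <-.
  by apply: measurable_funTS; have [] := hh k.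
exists h; split => // g C mC.
have mhE : measurable_fun setT (EFin \o h) by exact/measurable_EFinP.
have hge f : (0 <= (EFin \o h) f)%E by rewrite lee_fin; have /andP[] := h01 f.
have split_seqDU (mu : {measure set (mono R) -> \bar R}) :
    (mu C = \sum_(k <oo) mu (C `&` D' k))%E.
  have mCk k : measurable (C `&` D' k) by exact: measurableI.
  rewrite -[in LHS](setIT C) -D'T setI_bigcupr measure_semi_bigcup//.
    exact: trivIset_setIl.
  exact: bigcupT_measurable.
rewrite -(joint_lawE hxi P g mvA) split_seqDU.
rewrite -[RHS](densityE (law g) mhE hge) split_seqDU.
apply: eq_eseriesr => k _; rewrite joint_lawE densityE.
have [mhk hk01 hkE] := hh k.
have mCk : measurable (C `&` D' k) by exact: measurableI.
have CkD : C `&` D' k `<=` D k by move=> f [_ []].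
rewrite -[C `&` D' k in LHS](setIidl CkD) (P_avoids_restrict hxi hn hP)//.
rewrite hkE//; last first.
  by move=> x; rewrite [leRHS]/mono_eval /= le_max lexx orbT.
have mhkE : measurable_fun setT (EFin \o h_ k) by exact/measurable_EFinP.
have hkge f : (0 <= (EFin \o h_ k) f)%E.
  by rewrite lee_fin; have /andP[] := hk01 f.
rewrite -(integral_law_restrict hxi hn hP g mCk CkD mhkE hkge).
by apply: eq_integral => f /set_mem[_ /idxE fk]; rewrite /= /h fk.
Qed.

Lemma version_setT : common_version setT (cst 1).
Proof.
split => [|f|g B mB]; [exact: measurable_cst|by rewrite ler01 lexx|].
rewrite setTI (_ : (fun f => (cst 1 f)%:E) = cst 1%E)//.
by rewrite integral_cst// mul1e.
Qed.

Lemma version_setC E h : measurable E -> common_version E h ->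
  common_version (~` E) (fun f => 1 - h f).
Proof.
move=> mE [mh h01 hE]; split => [|f|g B mB].
- by apply: measurable_funB => //; exact: measurable_cst.
- by have /andP[h0 h1] := h01 f; rewrite subr_ge0 h1 gerBl.
have mSB := measurable_mle_preimage hxi mB.
have mhE : measurable_fun setT (EFin \o h) by exact/measurable_EFinP.
have sum1 : (P g (S @^-1` B) = P g (E `&` S @^-1` B) + P g (~` E `&` S @^-1` B))%E.
  rewrite -measureU.
  - by rewrite -setIUl setUv setTI.
  - exact: measurableI.
  - by apply: measurableI => //; exact: measurableC.
  - by rewrite setIACA setICr set0I.
have sum2 : (P g (S @^-1` B) = \int[law g]_(f in B) (h f)%:E +
    \int[law g]_(f in B) (1 - h f)%:E)%E.
  rewrite -ge0_integralD//; last first.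
  - apply/measurable_EFinP; apply: measurable_funTS.
    by apply: measurable_funB => //; exact: measurable_cst.
  - by move=> f _; have /andP[h0 h1] := h01 f; rewrite lee_fin subr_ge0.
  - exact: measurable_funTS.
  - by move=> f _; have /andP[h0 h1] := h01 f; rewrite lee_fin.
  under eq_integral do rewrite -EFinD addrC subrK.
  by rewrite integral_cst// mul1e.
have fin : P g (E `&` S @^-1` B) \is a fin_num.
  by apply: fin_num_measure; exact: measurableI.
rewrite sum1 -hE// in sum2.
move: fin sum2; set a := P g (E `&` _); set b := P g _; set c := integral _ _ _.
by move=> fa abc; rewrite -(addeK b fa) addeC (addeC b) abc -[RHS](addeK c fa) addeC (addeC c).
Qed.

Lemma version_null E E' h : measurable E -> measurable E' ->
  (forall g, exists2 N, measurable N /\ P g N = 0%E &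
     forall w, ~ N w -> E w <-> E' w) ->
  common_version E h -> common_version E' h.
Proof.
move=> mE mE' EE' [mh h01 hE]; split => // g B mB; rewrite -hE//.
have mSB := measurable_mle_preimage hxi mB.
have [N [mN N0] hN] := EE' g.
have le E1 E2 : measurable E1 -> measurable E2 ->
    (forall w, ~ N w -> E1 w -> E2 w) ->
    (P g (E1 `&` S @^-1` B) <= P g (E2 `&` S @^-1` B))%E.
  move=> m1 m2 E12; have mI := measurableI _ _ m2 mSB.
  rewrite -(measureU0 mI mN N0); apply: le_measure.
  - by apply/mem_set; exact: measurableI.
  - by apply/mem_set; exact: measurableU.
  - move=> w [E1w Bw]; have [|/E12 h2] := pselect (N w); first by right.
    by left; split => //; exact: h2.
by apply/eqP; rewrite eq_le !le// => w /hN[].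
Qed.

(** The sum of the versions may exceed 1 or be infinite at some functions. Its integrals are
    probabilities bounded by the law of the estimator, so clipping it preserves them. *)
Lemma version_bigcup (F : (set Omega)^nat) (h_ : nat -> mono R -> R) :
  (forall k, measurable (F k)) -> trivIset setT F ->
  (forall k, common_version (F k) (h_ k)) ->
  exists h, common_version (\bigcup_k F k) h.
Proof.
move=> mF tF hF.
pose phi f := (\sum_(k <oo) (h_ k f)%:E)%E.
have hk0 k f : (0 <= (h_ k f)%:E)%E.
  by have [_ /(_ f)/andP[h0 _] _] := hF k; rewrite lee_fin.
have mhk k : measurable_fun setT (EFin \o h_ k).
  by apply/measurable_EFinP; have [] := hF k.
have phi0 f : (0 <= phi f)%E by apply: nneseries_ge0.
have mphi : measurable_fun setT phi.
  by apply: ge0_emeasurable_sum => [k f _ _|k _]; [exact: hk0|exact: mhk].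
have hphi g B : measurable B ->
    P g (\bigcup_k F k `&` S @^-1` B) = (\int[law g]_(f in B) phi f)%E.
  move=> mB; have mSB := measurable_mle_preimage hxi mB.
  have mFk k : measurable (F k `&` S @^-1` B) by exact: measurableI.
  rewrite setI_bigcupl measure_semi_bigcup//.
  - rewrite /phi (@integral_nneseries _ _ _ (law g) B mB (fun k f => (h_ k f)%:E)
      (fun k => measurable_funTS (mhk k)) (fun k f _ => hk0 k f)).
    by apply: eq_eseriesr => k _; have [_ _ hk] := hF k; exact: hk.
  - exact: trivIset_setIr.
  - exact: bigcupT_measurable.
exists (clip phi); split => [|f|g B mB]; first exact: measurable_clip.
  exact: clip_bounds.
rewrite hphi// -integral_clip//.
  by apply: law_lty.
move=> C mC; rewrite -hphi//; apply: le_measure; last exact: subIsetr.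
  apply/mem_set/measurableI; first exact: bigcupT_measurable.
  exact: measurable_mle_preimage.
by apply/mem_set/measurable_mle_preimage.
Qed.

End CommonVersions.

(** * The process is determined by its avoidance events *)

Section Simple.
Variables (R : realType) (d : measure_display) (Omega : measurableType d).
Variable xi : nat -> Omega -> measurableTypeR R * measurableTypeR R.
Hypothesis hxi : point_process xi.

Local Notation plane := (measurableTypeR R * measurableTypeR R)%type.

Definition band (m : nat) : set plane := below m%:R `\` below (- m%:R).

Definition column (k i : nat) : set plane :=
  left_of (i.+1%:R / k.+1%:R) `\` left_of (i%:R / k.+1%:R).

Definition cell m k i := band m `&` column k i.

Lemma measurable_band m : measurable (band m).
Proof. by apply: measurableD; exact: measurable_below. Qed.

Lemma measurable_cell m k i : measurable (cell m k i).
Proof.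
apply: measurableI; first exact: measurable_band.
by apply: measurableD; exact: measurable_left_of.
Qed.

Lemma cell_below m k i : cell m k i `<=` below m%:R.
Proof. by move=> p [[]]. Qed.

Lemma trivIset_cell m k : trivIset setT (cell m k).
Proof.
apply: trivIset_setIl => i j _ _ [p [[]]]; rewrite /left_of /= => pi /negP.
rewrite -leNgt => ip [pj /negP]; rewrite -leNgt => jp.
apply/eqP; rewrite eqn_leq.
have k0 : 0 < (k.+1%:R^-1 : R) by rewrite invr_gt0.
have := le_lt_trans ip pj; rewrite ltr_pM2r// ltr_nat ltnS => ->.
by have := le_lt_trans jp pi; rewrite ltr_pM2r// ltr_nat ltnS => ->.
Qed.

(** The columns are half-open, so abscissa 1 falls into column [k.+1]; hence [k.+2] columns. *)
Lemma column_cover (k : nat) (p : plane) : 0 <= p.1 <= 1 ->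
  exists2 i, (i < k.+2)%N & column k i p.
Proof.
move=> /andP[p0 p1].
have k0 : 0 < (k.+1%:R : R) by [].
have : 0 <= p.1 * k.+1%:R by rewrite mulr_ge0.
move=> /truncn_itv; set i := Num.trunc _ => /andP[i1 i2].
exists i.
  rewrite ltnS -(ler_nat R) (le_trans i1)//.
  by rewrite -[leRHS]mul1r ler_wpM2r.
split; first by rewrite /left_of /= ltr_pdivlMr.
by apply/negP; rewrite -leNgt ler_pdivrMr.
Qed.

Lemma bigcup_band : \bigcup_m band m = setT.
Proof.
apply/seteqP; split=> // p _; exists (Num.bound p.2) => //; split.
  exact: unstable.ltr_bound.
by apply/negP; rewrite -leNgt lerNl ltW// unstable.ltrNbound.
Qed.

Lemma band_nondecreasing : nondecreasing_seq band.
Proof.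
move=> m m' mm'; apply/subsetPset => p [pm /negP]; rewrite /below /= -leNgt => mp.
split; first by rewrite /below /= (lt_le_trans pm)// ler_nat.
by apply/negP; rewrite -leNgt (le_trans _ mp)// lerN2 ler_nat.
Qed.

(* Depends on avoidance events only, and equals the count of [A] in the band as
   soon as no cell contains two points. *)
Definition occupied m k A w : \bar R :=
  (\sum_(i < k.+2) (\1_(~` avoids xi (A `&` cell m k i)) w)%:E)%E.

Lemma count_ge1 A w : ~ avoids xi A w -> (1 <= Defs.count xi A w)%E.
Proof.
move=> /existsNP[j /contrapT Aj].
apply: le_trans (nneseries_lim_ge j.+1 _) => //.
by rewrite big_nat_recr//= diracE mem_set//= leeDr// sume_ge0.
Qed.

Lemma count_avoids A w : avoids xi A w -> Defs.count xi A w = 0%E.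
Proof. by move=> h; apply/eqP; rewrite count_eq0; apply/mem_set. Qed.

Lemma occupied_le_count m k A w : measurable A ->
  (occupied m k A w <= Defs.count xi A w)%E.
Proof.
(* The counting measure of the points of [w]; its values are those of [count] by conversion. *)
move=> mA; pose mu : {measure set plane -> \bar R} :=
  mseries (fun j => \d_(xi j w)) 0.
have mAc i : measurable (A `&` cell m k i).
  by apply: measurableI => //; exact: measurable_cell.
have tAc : trivIset setT (fun i => A `&` cell m k i).
  by apply: trivIset_setIl; exact: trivIset_cell.
apply: (@le_trans _ _ (\sum_(i < k.+2) mu (A `&` cell m k i))%E).
  apply: lee_sum => i _; rewrite indicE -[leRHS]/(Defs.count xi _ w).
  case: (boolP (w \in _)) => [/set_mem/count_ge1//|_].
  exact: measure_ge0 mu _.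
rewrite -(measure_bigsetU mu mAc tAc) -[leRHS]/(mu A); apply: le_measure.
- by apply/mem_set/bigsetU_measurable => i _.
- exact/mem_set.
- by move=> p; rewrite -(bigcup_mkord _ (fun i => A `&` cell m k i)) => -[i _ []].
Qed.

(** At most one point in [Q], written as the two events whose probabilities the Poisson law
    gives. *)
Definition few (Q : set plane) : set Omega :=
  avoids xi Q `|` Defs.count xi Q @^-1` [set 1%:R%:E].

Definition crowded m k : set Omega :=
  \big[setU/set0]_(i < k.+2) ~` few (cell m k i).

Lemma measurable_few Q : measurable Q -> measurable (few Q).
Proof.
move=> mQ; apply: measurableU; first exact: (measurable_avoids hxi).
rewrite -[X in measurable X]setTI; exact: (measurable_count hxi).
Qed.

Lemma measurable_crowded m k : measurable (crowded m k).
Proof.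
apply: bigsetU_measurable => i _; apply: measurableC.
by apply: measurable_few; exact: measurable_cell.
Qed.

Lemma count_band_le_occupied m k A w : measurable A -> ~ crowded m k w ->
  (Defs.count xi (A `&` band m) w <= occupied m k A w)%E.
Proof.
move=> mA; rewrite /crowded -(bigcup_mkord _ (fun i => ~` few (cell m k i))) => nc.
pose mu : {measure set plane -> \bar R} :=
  mseries (fun j => \d_(xi j w)) 0.
have mAc i : measurable (A `&` cell m k i).
  by apply: measurableI => //; exact: measurable_cell.
have tAc : trivIset setT (fun i => A `&` cell m k i).
  by apply: trivIset_setIl; exact: trivIset_cell.
pose C : set plane := \big[setU/set0]_(i < k.+2) (A `&` cell m k i).
have mC : measurable C by apply: bigsetU_measurable => i _.
have mAB : measurable (A `&` band m) by apply: measurableI => //; exact: measurable_band.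
have mD : measurable (A `&` band m `\` C) by exact: measurableD.
(* The cells cover only part of the band, but all points have abscissa in [0, 1]. *)
have D0 : mu (A `&` band m `\` C) = 0%E.
  apply: count_avoids => j [[Aj bj]]; apply.
  have [_ /(_ j w) h01 _] := hxi.
  have [i ik ci] := column_cover k h01.
  by rewrite /C -(bigcup_mkord _ (fun i => A `&` cell m k i)); exists i.
apply: (@le_trans _ _ (mu C)).
  rewrite -[leRHS](measureU0 (mu := mu) mC mD D0).
  rewrite -[leLHS]/(mu (A `&` band m)); apply: le_measure.
  - exact/mem_set.
  - by apply/mem_set; exact: measurableU.
  - by move=> p Ap; have [|] := pselect (C p); [left|right].
rewrite /C (measure_bigsetU mu mAc tAc); apply: lee_sum => i _.
rewrite indicE -[leLHS]/(Defs.count xi _ w).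
have [h|h] := pselect (avoids xi (A `&` cell m k i) w).
  by rewrite count_avoids// lee_fin.
rewrite mem_set//.
have : few (cell m k i) w by apply: contrapT => nf; apply: nc; exists i => //=.
case => [av|/= <-].
  by exfalso; apply: h; apply: avoids_subset av; exact: subIsetr.
apply: (@le_measure _ _ _ mu); [exact/mem_set|apply/mem_set; exact: measurable_cell|].
exact: subIsetr.
Qed.

End Simple.

(** * Almost sure simplicity and sufficiency of the estimator *)

Section Sufficiency.
Variables (R : realType) (d : measure_display) (Omega : measurableType d).
Variable xi : nat -> Omega -> measurableTypeR R * measurableTypeR R.
Hypothesis hxi : point_process xi.
Variables (n : R) (hn : 1 <= n).
Variable P : mono R -> probability Omega R.
Hypothesis hP : forall g, poisson_process (P g) (intensity_measure n g) xi.

Local Notation plane := (measurableTypeR R * measurableTypeR R)%type.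
Local Notation S := (mon_mle xi : Omega -> mono R).
Local Notation mS := (measurable_mon_mle hxi).
Local Notation law := (law hxi P).
Local Notation Lam := (intensity_measure n).
Local Notation common_version := (common_version hxi P).

Definition avoid_events : set (set Omega) :=
  [set E | exists A, exists2 m : R, measurable A /\ A `<=` below m &
    E = avoids xi A].
Local Notation AvoidAlgebra := (g_sigma_algebraType avoid_events).

Lemma avoid_events_setI : setI_closed avoid_events.
Proof.
move=> _ _ [A [a [mA Aa] ->]] [B [b [mB Bb] ->]].
exists (A `|` B), (Num.max a b); last by rewrite avoidsU.
split; first exact: measurableU.
by move=> p [/Aa|/Bb]; rewrite /below /= lt_max => ->; rewrite ?orbT.
Qed.

Lemma avoid_events_measurable E : <<s avoid_events >> E -> measurable E.
Proof.
move: E; apply: smallest_sub; first exact: sigma_algebra_measurable.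
by move=> _ [A [a [mA Aa] ->]]; exact: (measurable_avoids hxi).
Qed.

Lemma avoid_events_version E : <<s avoid_events >> E ->
  exists h, common_version E h.
Proof.
move: E; apply: (@dynkin_induction _ AvoidAlgebra avoid_events) => //.
- exact: avoid_events_setI.
- by exists (cst 1); exact: version_setT.
- by move=> _ [A [a [mA Aa] ->]]; exact: (avoids_version hxi hn hP mA Aa).
- move=> E /avoid_events_measurable mE [h hE].
  by exists (fun f => 1 - h f); exact: version_setC.
- move=> F mF tF /choice[h hF]; have := @version_bigcup _ _ _ _ hxi P F h _ tF hF; apply => k.
  exact: (avoid_events_measurable (mF k)).
Qed.

(** With [r] the mass of [Q], the probability is 1 - exp(-r)(1 + r), and exp(-r) >= 1 - r bounds it
    by r^2. *)
Lemma P_not_few g Q (l : R) : measurable Q -> (Lam g Q <= l%:E)%E ->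
  (P g (~` few xi Q) <= (l ^+ 2)%:E)%E.
Proof.
move=> mQ Ql; have [h1 _ _] := hP g.
have := intensity_measure_ge0 hn g mQ.
case E : (Lam g Q) Ql => [r| |]//; rewrite !lee_fin => rl r0.
have Py : (Lam g Q < +oo)%E by rewrite E ltry.
have m1 : measurable (Defs.count xi Q @^-1` [set 1%:R%:E]).
  by rewrite -[X in measurable X]setTI; exact: (measurable_count hxi).
have m0 := measurable_avoids hxi mQ.
have Pfew : P g (few xi Q) = (expR (- r) * (1 + r))%:E.
  rewrite measureU//.
    have /= -> := h1 Q mQ Py 1%N.
    have /= -> := P_avoids hxi hn hP g mQ.
    by rewrite E /= -EFinD expr1 (_ : 1`!%:R = 1 :> R)// divr1 mulrDr mulr1.
  apply/seteqP; split=> // w [av /= c1].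
  have := count_avoids av; rewrite c1 => /eqP.
  by rewrite eqe oner_eq0.
have /= -> := probability_setC (P g) (measurable_few hxi mQ).
rewrite Pfew -EFinB lee_fin.
have := expR_ge1Dx (- r).
by move: (expR (- r)) => e he; nra.
Qed.

Lemma cell_intensity g m k i :
  (Lam g (cell m k i) <= (n * (2 * m%:R) / k.+1%:R)%:E)%E.
Proof.
have k0 : 0 < (k.+1%:R : R) by [].
have := @intensity_measure_rectangle R n hn g (i%:R / k.+1%:R) (i.+1%:R / k.+1%:R)
  (- m%:R) m%:R (cell m k i) _ _ (measurable_cell m k i) _.
rewrite (_ : n * _ = n * (2 * m%:R) / k.+1%:R); last first.
  have k1 : k.+1%:R != 0 :> R by rewrite pnatr_eq0.
  by rewrite -mulrBl -natrB// subSnn; move: (k.+1%:R) k1 => z z0; field.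
apply.
- by rewrite ler_pM2r ?invr_gt0// ler_nat.
- by rewrite ge0_cp.
move=> p [[[pm /negP mp] [pi /negP ip]] _].
rewrite /left_of /below /= -!leNgt in pm mp pi ip.
by split; rewrite /= in_itv /= ?ip ?mp ltW.
Qed.

(** Union bound over [k.+2] cells, each contributing at most (c/(k+1))^2; the factor 2 bounds
    (k+2)/(k+1). *)
Lemma P_crowded g m k : (P g (crowded xi m k) <=
  (2 * (n * (2 * m%:R)) ^+ 2 / k.+1%:R)%:E)%E.
Proof.
set c := n * (2 * m%:R).
have boole K : (P g (\big[setU/set0]_(i < K) ~` few xi (cell m k i)) <=
    (K%:R * (c / k.+1%:R) ^+ 2)%:E)%E.
  have mF i : measurable (~` few xi (cell m k i)).
    by apply: measurableC; apply: (measurable_few hxi); exact: measurable_cell.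
  elim: K => [|K ih]; first by rewrite big_ord0 measure0 mul0r.
  rewrite big_ord_recr/=; apply: le_trans (measureU2 _ _ _) _ => //.
    exact: bigsetU_measurable.
  rewrite -[K.+1]addn1 natrD mulrDl mul1r EFinD; apply: leeD => //.
  by apply: P_not_few; [exact: measurable_cell|exact: cell_intensity].
apply: le_trans (boole _) _; rewrite lee_fin expr_div_n.
have k0 : 0 < (k.+1%:R : R) by [].
have -> : k.+2%:R * (c ^+ 2 / k.+1%:R ^+ 2) = (k.+2%:R / k.+1%:R) * (c ^+ 2 / k.+1%:R) :> R.
  by move: (k.+1%:R) (gt_eqF k0) => z /negbT z0; field.
rewrite -[leRHS]mulrA ler_wpM2r//; first by rewrite divr_ge0// sqr_ge0.
by rewrite ler_pdivrMr// -natrM ler_nat mul2n doubleS !ltnS -addnn leq_addl.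
Qed.

(** Some band stays crowded under every subdivision. As cells split a band by abscissa only, this
    includes outcomes where two points share an abscissa, not just coinciding points. *)
Definition non_simple : set Omega := \bigcup_m \bigcap_k crowded xi m k.

Lemma measurable_non_simple : measurable non_simple.
Proof.
apply: bigcupT_measurable => m; apply: bigcap_measurableType => k _.
exact: measurable_crowded.
Qed.

Lemma P_non_simple g : P g non_simple = 0%E.
Proof.
apply: measure_negligible; first exact: measurable_non_simple.
apply: negligible_bigcup => m.
have mI : measurable (\bigcap_k crowded xi m k).
  by apply: bigcap_measurableType => k _; exact: measurable_crowded.
apply/negligibleP => //; apply/eqP; rewrite eq_le measure_ge0 andbT.
set c := 2 * (n * (2 * m%:R)) ^+ 2.
have le k : (P g (\bigcap_k crowded xi m k) <= (c / k.+1%:R)%:E)%E.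
  apply: le_trans (P_crowded g m k); apply: le_measure.
  - exact/mem_set.
  - by apply/mem_set; exact: measurable_crowded.
  - by move=> w; apply.
have fin : P g (\bigcap_k crowded xi m k) \is a fin_num by exact: fin_num_measure.
move: le; change ((forall k, P g (\bigcap_k crowded xi m k) <= (c / k.+1%:R)%:E) ->
  P g (\bigcap_k crowded xi m k) <= 0)%E.
move: fin; case: (P g _) => // p _ le.
rewrite lee_fin leNgt; apply/negP => p0.
have c0 : 0 <= c by rewrite mulr_ge0// sqr_ge0.
(* Dividing by [c + 1] rather than [c] covers the case [c = 0]. *)
have [k hk] := ltr_add_invr (divr_gt0 p0 (ltr_wpDl c0 ltr01)).
have := le k; rewrite lee_fin leNgt => /negP; apply.
move: hk; rewrite add0r => hk.
have c1 : 0 < c + 1 by rewrite ltr_wpDl.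
rewrite ltr_pdivlMr// in hk.
apply: le_lt_trans hk; rewrite mulrC ler_wpM2l ?invr_ge0//.
by rewrite lerDl.
Qed.

(** [esups] at index 0 is the supremum of the whole sequence; countable suprema keep the count
    measurable for the avoidance events. *)
Definition observed_count A (w : Omega) : \bar R :=
  esups (fun m => esups (fun k => occupied xi m k A w) 0) 0.

Lemma measurable_observed_count A : measurable A ->
  measurable_fun setT (observed_count A : AvoidAlgebra -> \bar R).
Proof.
move=> mA; apply: measurable_fun_esups => m; apply: measurable_fun_esups => k.
apply: emeasurable_sum => i; apply/measurable_EFinP.
apply: measurable_indic; apply: measurableC; apply: sub_sigma_algebra.
exists (A `&` cell m k i), m%:R => //; split.
  by apply: measurableI => //; exact: measurable_cell.
by move=> p [_ /cell_below].
Qed.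

(** Occupied cells never outnumber the points. Conversely, each band has an uncrowded subdivision,
    and the counts in the bands increase to the full count. *)
Lemma observed_countE A w : measurable A -> ~ non_simple w ->
  observed_count A w = Defs.count xi A w.
Proof.
move=> mA ns; apply/eqP; rewrite eq_le; apply/andP; split.
  apply: ge_ereal_sup => _ [m _ <-]; apply: ge_ereal_sup => _ [k _ <-].
  exact: occupied_le_count.
pose mu : {measure set plane -> \bar R} := mseries (fun j => \d_(xi j w)) 0.
have mAb m : measurable (A `&` band m).
  by apply: measurableI => //; exact: measurable_band.
have UA : \bigcup_m (A `&` band m) = A by rewrite -setI_bigcupr bigcup_band setIT.
have ndA : nondecreasing_seq (fun m => A `&` @band R m).
  move=> m m' mm'; apply/subsetPset; apply: setIS.
  exact/subsetPset/band_nondecreasing.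
have cv := nondecreasing_cvg_mu (mu := mu) mAb (bigcupT_measurable _ mAb) ndA.
rewrite UA in cv.
have -> : Defs.count xi A w = limn (mu \o (fun m => A `&` @band R m)).
  by apply/esym; exact: cvg_lim cv.
apply: lime_le; first by apply/cvg_ex; eexists; exact: cv.
apply: nearW => m /=.
have [k nk] : exists k, ~ crowded xi m k w.
  by apply/existsNP => ck; apply: ns; exists m => // k _; exact: ck.
apply: le_trans (count_band_le_occupied hxi mA nk) _.
apply: le_trans (ereal_sup_ubound _); last by exists m.
by apply: ereal_sup_ubound; exists k.
Qed.

(** The events with such an [E'] form a sigma-algebra: the exceptional set is the same for all of
    them, so complements and countable unions go through outcome by outcome. *)
Lemma observed_modulo_null E : observed_events xi E ->
  exists2 E', <<s avoid_events >> E' & forall w, ~ non_simple w -> E w <-> E' w.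
Proof.
move: E; apply: smallest_sub.
  split.
  - by exists set0 => //; exact: (@measurable0 _ AvoidAlgebra).
  - move=> E [E' mE' EE']; exists (~` E').
      exact: (@measurableC _ AvoidAlgebra).
    move=> w /EE' h; rewrite setTD /setC /=.
    by split; apply: contra_not => /h.
  - move=> F hF.
    have /choice[F' hF'] : forall i, exists E', <<s avoid_events >> E' /\
        forall w, ~ non_simple w -> F i w <-> E' w.
      by move=> i; have [E' h1 h2] := hF i; exists E'.
    exists (\bigcup_i F' i).
      by apply: (@bigcupT_measurable _ AvoidAlgebra) => i; have [] := hF' i.
    by move=> w ns; split=> -[i _ Fi]; exists i => //; have [_ h] := hF' i;
      exact/(h _ ns).
move=> _ [A [B [mA mB ->]]]; exists (observed_count A @^-1` B).
  by have := measurable_observed_count mA measurableT mB; rewrite setTI.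
by move=> w ns /=; rewrite observed_countE.
Qed.

Lemma sufficient_mon_mle : sufficient_statistic P (observed_events xi) S.
Proof.
move=> E oE; have mE := observed_measurable hxi oE.
have [E' /[dup] mE' /avoid_events_version[h hE'] EE'] := observed_modulo_null oE.
exists h => g.
have [mh h01 hE] : common_version E h.
  apply: version_null hE' => //; first exact: avoid_events_measurable.
  move=> g'; exists non_simple => [|w /EE' EwE'].
    by split; [exact: measurable_non_simple|exact: P_non_simple].
  by split => /EwE'.
have mhS : measurable_fun setT (h \o S) by exact: measurableT_comp mh mS.
split => // [|B mB].
  apply: measurable_bounded_integrable => //.
    by apply: le_lt_trans (probability_le1 (P g) measurableT) (ltry 1).
  exists 1; split => // M M1 w _ /=.
  have /andP[h0 h1] := h01 (S w).
  by rewrite ger0_norm// (le_trans h1)// ltW.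
rewrite hE// integral_law//; first exact/measurable_EFinP.
by move=> f; rewrite lee_fin; have /andP[] := h01 f.
Qed.

Lemma ae_mon_mle g : {ae P g, forall w, is_mon_mle (xi ^~ w) (S w)}.
Proof.
exists (~` regular xi); split.
- by apply: measurableC; exact: (measurable_regular hxi).
- exact: (not_regular_null hxi hn hP).
- by move=> w /=; apply: contra_not => -[gw _]; exact: (mon_mleP hxi).
Qed.

End Sufficiency.

Theorem proposition3p8 (R : realType) (n : R) (hn : 1 <= n)
    (d : measure_display) (Omega : measurableType d)
    (P : mono R -> probability Omega R)
    (xi : nat -> Omega -> measurableTypeR R * measurableTypeR R)
    (hxi : point_process xi)
    (hP : forall g : mono R, poisson_process (P g) (intensity_measure n g) xi) :
  [/\ statistic (observed_events xi) (mon_mle xi),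
      forall g : mono R,
        {ae P g, forall w, is_mon_mle (xi ^~ w) (mon_mle xi w)},
      sufficient_statistic P (observed_events xi) (mon_mle xi) &
      complete_statistic P (mon_mle xi)].
Proof.
split.
- exact: statistic_mon_mle.
- exact: (ae_mon_mle hxi hn hP).
- exact: (sufficient_mon_mle hxi hn hP).
- exact: (complete_mon_mle hxi hn hP).
Qed.
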